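(* For a Banach lattice $E$, the following are equivalent: (1) every almost Grothendieck subset of $E$ is relatively weakly compact; (2) for every Banach space $X$, every almost Grothendieck operator $T: X \to E$ is weakly compact; (3) every almost Grothendieck operator $T: \ell_1 \to E$ is weakly compact.
   Context: Every bounded linear operator $S: E \to c_0$ has the form $S(x) = (x_n'(x))_n$ for a unique weak* null sequence $(x_n') \subset E'$; $S$ is a disjoint operator if $(x_n')$ is disjoint in the dual Banach lattice $E'$. A subset $A \subset E$ is almost Grothendieck if $S(A)$ is relatively weakly compact in $c_0$ for every disjoint operator $S: E \to c_0$. A bounded operator $T: X \to E$ from a Banach space $X$ is almost Grothendieck if $T'y_n' \to 0$ weakly in $X'$ for every disjoint weak* null sequence $(y_n') \subset E'$. *)

(* Defs.v *)
From mathcomp Require Import all_boot all_algebra all_classical all_reals all_analysis.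
Import GRing.Theory Num.Theory numFieldNormedType.Exports.
Local Open Scope ring_scope.
Local Open Scope classical_set_scope.

Set Implicit Arguments.
Unset Strict Implicit.
Unset Printing Implicit Defensive.

(* Generic "presented" normed spaces: a linear subspace P of an lmodType V   *)
(* together with a norm function N.  A genuine normed space X is presented  *)
(* as (V, P, N) = (X, setT, normr); l_1 and c_0 are presented as subspaces  *)
(* of nat -> R with their usual norms.                                      *)

Section Presented.
Variables (R : realType) (V : lmodType R).

Definition lin_on (P : set V) (W : lmodType R) (T : V -> W) : Prop :=
  forall (a : R) (u v : V), P u -> P v -> T (a *: u + v) = a *: T u + T v.

Definition dual_on (P : set V) (N : V -> R) (f : V -> R) : Prop :=
  lin_on P (f : V -> R^o) /\ exists C : R, forall u, P u -> `|f u| <= C * N u.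

Definition dual_norm (P : set V) (N : V -> R) (f : V -> R) : R :=
  sup [set r : R | exists u, [/\ P u, N u <= 1 & r = `|f u|]].

Definition weak_nbhd (Phi : set (V -> R)) (p : V) (Q : set V) : Prop :=
  exists (n : nat) (fs : nat -> V -> R) (eps : R),
    [/\ (forall i, (i < n)%N -> Phi (fs i)), 0 < eps &
        forall u, (forall i, (i < n)%N -> `|fs i u - fs i p| < eps) -> Q u].

Definition weak_closure (P : set V) (Phi : set (V -> R)) (B : set V) : set V :=
  [set p | P p /\ forall Q, weak_nbhd Phi p Q -> exists b, B b /\ Q b].

(* weak compactness, via filters exactly as in mathcomp's [compact] *)
Definition weak_compact (Phi : set (V -> R)) (K : set V) : Prop :=
  forall F : set_system V, ProperFilter F -> F K ->
    exists p, K p /\ forall U Q, F U -> weak_nbhd Phi p Q -> exists u, U u /\ Q u.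

Definition rel_weak_compact (P : set V) (N : V -> R) (B : set V) : Prop :=
  weak_compact (dual_on P N) (weak_closure P (dual_on P N) B).

End Presented.

Definition dual_space (R : realType) (V : lmodType R) (P : set V) (N : V -> R)
  : set (V -> R) := dual_on P N.

Definition l1 (R : realType) : set (nat -> R) :=
  [set u : nat -> R | cvgn (series (fun k => `|u k| : R))].
Definition l1norm (R : realType) (u : nat -> R) : R :=
  limn (series (fun k => `|u k| : R)).

Definition c0 (R : realType) : set (nat -> R) :=
  [set u : nat -> R | u @ \oo --> (0 : R)].
Definition c0norm (R : realType) (u : nat -> R) : R :=
  sup (range (fun n => `|u n|)).

Section BanachLattice.
Variables (R : realType) (E : completeNormedModType R) (j : E -> E -> E).

Definition lat_le (x y : E) : Prop := j x y = y.
Definition lat_abs (x : E) : E := j x (- x).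

Definition is_banach_lattice : Prop :=
  [/\ (forall x y, j x y = j y x),
      (forall x y z, j x (j y z) = j (j x y) z) /\ (forall x, j x x = x),
      (forall x y z, lat_le x y -> lat_le (x + z) (y + z)),
      (forall (a : R) x y, 0 <= a -> lat_le x y -> lat_le (a *: x) (a *: y))
    & (forall x y, lat_le (lat_abs x) (lat_abs y) -> `|x| <= `|y|)].

Definition Edual : set (E -> R) := dual_on setT (@Num.norm R E).

Definition dual_le (f g : E -> R) : Prop :=
  forall x, lat_le 0 x -> f x <= g x.

Definition dual_is_sup (f g s : E -> R) : Prop :=
  [/\ Edual s, dual_le f s, dual_le g s &
      forall h, Edual h -> dual_le f h -> dual_le g h -> dual_le s h].
Definition dual_is_inf (f g s : E -> R) : Prop :=
  [/\ Edual s, dual_le s f, dual_le s g &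
      forall h, Edual h -> dual_le h f -> dual_le h g -> dual_le h s].

Definition dual_disjoint (f g : E -> R) : Prop :=
  exists a b, [/\ dual_is_sup f (fun x => - f x) a,
                  dual_is_sup g (fun x => - g x) b &
                  dual_is_inf a b (fun _ => 0)].

Definition disjoint_seq (y : nat -> E -> R) : Prop :=
  forall n m, n <> m -> dual_disjoint (y n) (y m).

Definition weak_star_null (y : nat -> E -> R) : Prop :=
  (forall n, Edual (y n)) /\ forall x, (fun n => y n x) @ \oo --> (0 : R).

(* Disjoint operators S : E -> c_0 are exactly  S x = (y_n x)_n  with (y_n)
   a disjoint weak* null sequence in E'. *)
Definition almost_grothendieck_set (A : set E) : Prop :=
  forall y, weak_star_null y -> disjoint_seq y ->
    rel_weak_compact (@c0 R) (@c0norm R) [set (fun n => y n x) | x in A].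

Definition bounded_op (V : lmodType R) (P : set V) (N : V -> R) (T : V -> E)
  : Prop :=
  lin_on P T /\ exists C : R, forall u, P u -> `|T u| <= C * N u.

(* almost Grothendieck operator: T' y_n -> 0 weakly in X' for every disjoint
   weak* null (y_n) in E'.  Here T' y = y \o T, and weak convergence in X'
   is tested against every bounded linear functional on X' (i.e. X''). *)
Definition almost_grothendieck_op (V : lmodType R) (P : set V) (N : V -> R)
  (T : V -> E) : Prop :=
  forall y, weak_star_null y -> disjoint_seq y ->
    forall Psi : (V -> R) -> R,
      dual_on (dual_space P N) (dual_norm P N) Psi ->
      (fun n => Psi (fun u => y n (T u))) @ \oo --> (0 : R).

Definition weakly_compact_op (V : lmodType R) (P : set V) (N : V -> R)
  (T : V -> E) : Prop :=
  rel_weak_compact setT (@Num.norm R E) [set T u | u in [set u | P u /\ N u <= 1]].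

End BanachLattice.

(* Main.v *)
(** (1) => (2): if [T] is almost Grothendieck and [S] is a disjoint operator into c_0, the bidual of
    [S T] takes its values in c_0, so [S T] maps the unit ball to a relatively weakly compact set.
    (3) => (1): an almost Grothendieck set [A] is bounded, since (f, 0, 0, ...) is a disjoint weak*
    null sequence for every positive [f]. Given a_n in [A], the operator T u = sum_n u_n a_n on l_1
    is almost Grothendieck: if y_n is disjoint weak* null and Psi (T' y_n) does not tend to 0, where
    Psi is a bounded functional on l_infty, then the sets {k : |y_n (a_k)| > eps} have
    finitely additive measure bounded below for infinitely many n; infinitely many of them have the
    finite intersection property, and points k_j of the successive intersections give a sequence
    (y_n (a_(k_j)))_n in c_0 without weak cluster point there. Hence T is weakly compact, (a_n) has a
    weak cluster point, and the Eberlein-Smulian theorem applies. *)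

From HB Require Import structures.
Require Import Defs.
From mathcomp Require Import all_boot all_order all_algebra all_classical all_reals all_analysis.
From mathcomp Require Import ring lra.
Import Order.TTheory GRing.Theory Num.Theory numFieldNormedType.Exports.
Local Open Scope ring_scope.
Local Open Scope classical_set_scope.

Set Implicit Arguments.
Unset Strict Implicit.
Unset Printing Implicit Defensive.

(** * Subspaces and the Hahn-Banach theorem *)

(** Elements of a bidual are not taken from a compactness theorem: they are limits, along an
    ultrafilter, of evaluations at points of the space. Such a limit gives the cluster point in c_0
    for (1) => (2), and it reduces Eberlein-Smulian to showing that one functional on the dual is an
    evaluation. Norm boundedness of [A] is not immediate from boundedness under each positive
    functional, since a general functional would first have to be split into positive ones inside
    E'. Instead, points a_n of growing norm receive positive functionals g_n that recover half of
    their norms, and uniform boundedness is applied on l_1, whose elements u parametrize the sums of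
    the u_k g_k: there only the scalars u_k have to be split. The measure attached to Psi is its
    variation, the supremum of Psi over sequences bounded by the indicator of a set. Duals are sets
    of functions on an ambient module, so Hahn-Banach is stated relative to a subspace. The step (2)
    => (3) is a specialization, once l_1 is a complete normed module. *)

Definition is_subspace (R : realType) (V : lmodType R) (P : set V) : Prop :=
  P 0 /\ forall (a : R) u v, P u -> P v -> P (a *: u + v).

Section Subspace.
Context (R : realType) (V : lmodType R) (P : set V).
Hypothesis subP : is_subspace P.

Lemma subspace0 : P 0. Proof. by case: subP. Qed.
Lemma subspaceD u v : P u -> P v -> P (u + v).
Proof. by move=> Pu Pv; rewrite -[u]scale1r; case: subP => _; apply. Qed.
Lemma subspaceZ a u : P u -> P (a *: u).
Proof. by move=> Pu; rewrite -[_ *: _]addr0; case: subP => P0; apply. Qed.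
Lemma subspaceN u : P u -> P (- u).
Proof. by move=> Pu; rewrite -scaleN1r; exact: subspaceZ. Qed.
Lemma subspaceB u v : P u -> P v -> P (u - v).
Proof. by move=> Pu Pv; apply: subspaceD => //; exact: subspaceN. Qed.
Lemma subspace_sum n (u : nat -> V) :
  (forall i, (i < n)%N -> P (u i)) -> P (\sum_(i < n) u i).
Proof.
elim: n => [|n IHn] Pu; first by rewrite big_ord0; exact: subspace0.
rewrite big_ord_recr; apply: subspaceD; last exact: Pu.
by apply: IHn => i /ltnW; exact: Pu.
Qed.

Section LinOn.
Context (W : lmodType R) (T : V -> W).
Hypothesis linT : lin_on P T.

Lemma lin_on0 : T 0 = 0.
Proof.
have := linT 1 subspace0 subspace0.
by rewrite !scale1r addr0 => /eqP; rewrite -[eqbLHS]addr0 (inj_eq (addrI _)) eq_sym => /eqP.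
Qed.
Lemma lin_onD u v : P u -> P v -> T (u + v) = T u + T v.
Proof. by move=> Pu Pv; rewrite -[u in LHS]scale1r linT// scale1r. Qed.
Lemma lin_onZ a u : P u -> T (a *: u) = a *: T u.
Proof. by move=> Pu; rewrite -[_ *: u]addr0 linT ?lin_on0 ?addr0//; exact: subspace0. Qed.
Lemma lin_onN u : P u -> T (- u) = - T u.
Proof. by move=> Pu; rewrite -scaleN1r lin_onZ// scaleN1r. Qed.
Lemma lin_onB u v : P u -> P v -> T (u - v) = T u - T v.
Proof. by move=> Pu Pv; rewrite lin_onD ?lin_onN//; exact: subspaceN. Qed.
Lemma lin_on_sum n (u : nat -> V) :
  (forall i, (i < n)%N -> P (u i)) ->
  T (\sum_(i < n) u i) = \sum_(i < n) T (u i).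
Proof.
elim: n => [|n IHn] Pu; first by rewrite !big_ord0 lin_on0.
rewrite !big_ord_recr/= lin_onD ?IHn//; last 2 first.
- by apply: subspace_sum => i /ltnW; exact: Pu.
- exact: Pu.
by move=> i /ltnW; exact: Pu.
Qed.

End LinOn.

Lemma fct_combE (U : Type) a (f g : U -> R) x : (a *: f + g) x = a * f x + g x.
Proof. by []. Qed.

Lemma fct_subE (U : Type) (f g : U -> R) x : (f - g) x = f x - g x.
Proof. by []. Qed.

Lemma fct_scaleE (U : Type) a (f : U -> R) x : (a *: f) x = a * f x.
Proof. by []. Qed.

Lemma linfunP (f : V -> R) : lin_on P (f : V -> R^o) <->
  forall a u v, P u -> P v -> f (a *: u + v) = a * f u + f v.
Proof. by []. Qed.

Lemma linfunZ (f : V -> R) a u :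
  lin_on P (f : V -> R^o) -> P u -> f (a *: u) = a * f u.
Proof. by move=> /lin_onZ; apply. Qed.

End Subspace.

Section HahnBanach.
Context (R : realType) (V : lmodType R) (P : set V) (p : V -> R).
Hypothesis subP : is_subspace P.
Hypothesis pD : forall u v, P u -> P v -> p (u + v) <= p u + p v.
Hypothesis pZ : forall a u, 0 < a -> P u -> p (a *: u) = a * p u.

(** Partial linear functionals are kept as linear relations. Domination forces them to be
    single-valued: (u, r) and (u, s) yield (0, s - r), whence s - r <= p 0 = 0. *)
Let dominated_graph (G : set (V * R)) : Prop :=
  (forall a u v r s, G (u, r) -> G (v, s) -> G (a *: u + v, a * r + s)) /\
  forall u r, G (u, r) -> P u /\ r <= p u.

(** Sublinearity places every r - p (u - x) below every p (v + x) - s, so a value c at x fits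
    between the two families; the supremum of the first is taken. Scaling by the inverse of |t|
    brings domination at u + t x back to one of these two bounds. *)
Lemma dominated_graph_extend (G : set (V * R)) x :
  dominated_graph G -> G (0, 0) -> P x ->
  exists c, dominated_graph [set ur | exists v s t,
    [/\ G (v, s), ur.1 = v + t *: x & ur.2 = s + t * c]].
Proof.
move=> [GL Gp] G0 Px.
have key u r v s : G (u, r) -> G (v, s) -> r - p (u - x) <= p (v + x) - s.
  move=> Gu Gv; rewrite lerBrDr addrAC lerBlDr.
  have [Pu _] := Gp _ _ Gu; have [Pv _] := Gp _ _ Gv.
  have := GL 1 _ _ _ _ Gu Gv; rewrite scale1r mul1r => /Gp[_ /le_trans]; apply.
  have -> : u + v = (v + x) + (u - x) by rewrite addrACA addrN addr0 addrC.
  by apply: pD; [exact: subspaceD|exact: subspaceB].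
pose A := [set r | exists us, G us /\ r = us.2 - p (us.1 - x)].
have supA : has_sup A.
  split; first by exists (0 - p (0 - x)), (0, 0).
  by exists (p (0 + x) - 0) => _ [[u r] [/= Gu ->]]; exact: key.
exists (sup A); split.
  move=> a u v r s [u' [r' [t [Gu /= -> ->]]]] [v' [s' [t' [Gv /= -> ->]]]].
  exists (a *: u' + v'), (a * r' + s'), (a * t + t'); split; first exact: GL.
    by rewrite scalerDr scalerDl scalerA addrACA.
  by ring.
move=> _ _ [u [r [t [Gu /= -> ->]]]].
have [Pu ru] := Gp _ _ Gu.
split; first by apply: subspaceD => //; exact: subspaceZ.
have scaleG a : G (a *: u, a * r).
  by have := GL a _ _ _ _ Gu G0; rewrite !addr0.
have [t0|t0|->] := ltgtP t 0; last by rewrite scale0r mul0r !addr0.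
- have Nt0 : 0 < (- t)^-1 by rewrite invr_gt0 oppr_gt0.
  have : (- t)^-1 * r - p ((- t)^-1 *: u - x) <= sup A.
    by apply: ub_le_sup; [case: supA|exists ((- t)^-1 *: u, (- t)^-1 * r)].
  have -> : (- t)^-1 *: u - x = (- t)^-1 *: (u + t *: x).
    by rewrite scalerDr scalerA invrN mulNr mulVf ?lt_eqF// scaleN1r.
  rewrite pZ//; last by apply: subspaceD => //; exact: subspaceZ.
  by rewrite -mulrBr ler_pdivrMl ?oppr_gt0// mulNr; lra.
- have t'0 : 0 < t^-1 by rewrite invr_gt0.
  have : sup A <= p (t^-1 *: u + x) - t^-1 * r.
    apply: ge_sup; first by case: supA.
    by move=> _ [[v s] [/= Gv ->]]; exact: key.
  have -> : t^-1 *: u + x = t^-1 *: (u + t *: x).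
    by rewrite scalerDr scalerA mulVf ?gt_eqF// scale1r.
  rewrite pZ//; last by apply: subspaceD => //; exact: subspaceZ.
  by rewrite -mulrBr ler_pdivlMl//; lra.
Qed.

Theorem hahn_banach (W : set V) (g : V -> R) :
  is_subspace W -> W `<=` P -> lin_on W (g : V -> R^o) ->
  (forall u, W u -> g u <= p u) ->
  exists h : V -> R, [/\ lin_on P (h : V -> R^o), forall u, W u -> h u = g u &
    forall u, P u -> h u <= p u].
Proof.
move=> subW WP ling gp.
pose graph := [set ur : V * R | W ur.1 /\ ur.2 = g ur.1].
have domgraph : dominated_graph graph.
  split=> /=.
    move=> a u v r s [/= Wu ->] [/= Wv ->]; split=> /=; first by case: subW => _; apply.
    by rewrite (ling a u v).
  by move=> u r [/= Wu ->]; split; [exact: WP|exact: gp].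
(* adding [graph] to each member makes the empty chain harmless *)
pose S (G : set (V * R)) := dominated_graph (G `|` graph).
have [F FS totF|G [[GL Gp] maxG]] := @Zorn_bigcup _ S.
  have common x y : (\bigcup_(X in F) X `|` graph) x -> (\bigcup_(X in F) X `|` graph) y ->
      exists G, [/\ dominated_graph G, G x, G y & G `<=` \bigcup_(X in F) X `|` graph].
    have sub G : F G -> G `|` graph `<=` \bigcup_(X in F) X `|` graph.
      by move=> FG z [Gz|gz]; [left; exists G|right].
    move=> [[G FG Gx]|gx] [[H FH Hy]|gy].
    - have [GH|HG] := totF _ _ FG FH.
        by exists (H `|` graph); split; [exact: FS|left; exact: GH|left|exact: sub].
      by exists (G `|` graph); split; [exact: FS|left|left; exact: HG|exact: sub].
    - by exists (G `|` graph); split; [exact: FS|left|right|exact: sub].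
    - by exists (H `|` graph); split; [exact: FS|right|left|exact: sub].
    - by exists graph; split=> // z; right.
  split=> [a u v r s ux vx|u r ux].
    by have [G [[GL _] Gu Gv]] := common _ _ ux vx; apply; exact: GL.
  by have [G [[_ Gp] Gu _ _]] := common _ _ ux ux; exact: Gp.
have G0 : (G `|` graph) (0, 0).
  by right; split=> /=; [exact: subspace0|rewrite (lin_on0 subW ling)].
have total u : P u -> exists r, (G `|` graph) (u, r).
  move=> Pu; have [c domc] := dominated_graph_extend (conj GL Gp) G0 Pu.
  (* If the maximal graph had no value at [u], the extension through [u], which contains (u, c),
     would be strictly larger. *)
  apply: contrapT => /forallNP noru.
  set H := (X in dominated_graph X) in domc; apply: (maxG H); last first.
  - rewrite /S; suff -> : H `|` graph = H by [].
    apply/seteqP; split=> [[v s] [//|gv]|v Hv]; last by left.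
    by exists v, s, 0; split; [right|rewrite scale0r addr0|rewrite mul0r addr0].
  - split=> [[v s] Gv|HG].
      by exists v, s, 0; split; [left|rewrite scale0r addr0|rewrite mul0r addr0].
    apply: (noru c); left; apply: HG.
    by exists 0, 0, 1; split=> //=; rewrite ?scale1r ?mul1r add0r.
have funct u r s : (G `|` graph) (u, r) -> (G `|` graph) (u, s) -> r = s.
  suff le r' s' : (G `|` graph) (u, r') -> (G `|` graph) (u, s') -> s' <= r'.
    by move=> Gr Gs; apply/eqP; rewrite eq_le !le.
  move=> Gr Gs; have := GL (-1) _ _ _ _ Gr Gs.
  rewrite scaleN1r addNr => /Gp[_].
  suff -> : p 0 = 0 by lra.
  by have := @pZ 2 0 (ltr0n _ 2) (subspace0 subP); rewrite scaler0; lra.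
pose h u := get [set r | (G `|` graph) (u, r)].
have hP u : P u -> (G `|` graph) (u, h u) by move=> /total; exact: getPex.
exists h; split=> [a u v Pu Pv|u Wu|u Pu].
- apply: (@funct (a *: u + v)); first by apply: hP; case: subP => _; apply.
  exact: GL (hP _ Pu) (hP _ Pv).
- by apply: (@funct u); [exact: hP (WP _ Wu)|right].
- by have [] := Gp _ _ (hP _ Pu).
Qed.

End HahnBanach.

(** * Weak compactness and ultrafilter limits *)

Section WeakCompactness.
Context (R : realType) (V : lmodType R) (P : set V) (N : V -> R).

Let weak_entourage (W : set (V * V)) : Prop :=
  exists n (fs : nat -> V -> R) eps, [/\ forall i, (i < n)%N -> dual_on P N (fs i),
    0 < eps & forall u v, (forall i, (i < n)%N -> `|fs i u - fs i v| < eps) -> W (u, v)].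

Lemma weak_entourageI W1 W2 :
  weak_entourage W1 -> weak_entourage W2 -> weak_entourage (W1 `&` W2).
Proof.
move=> [n1 [f1 [e1 [Pf1 e1_gt0 W1P]]]] [n2 [f2 [e2 [Pf2 e2_gt0 W2P]]]].
exists (n1 + n2)%N, (fun i => if (i < n1)%N then f1 i else f2 (i - n1)%N), (Num.min e1 e2).
split=> [i ilt||u v uv]; last split.
- by case: ltnP => // ?; [exact: Pf1|apply: Pf2; rewrite ltn_subLR].
- by rewrite lt_min e1_gt0.
- apply: W1P => i i1; have := uv i (ltn_addr _ i1).
  by rewrite i1 lt_min => /andP[].
- apply: W2P => i i2; have := uv (n1 + i)%N; rewrite ltn_add2l => /(_ i2).
  by rewrite ltnNge leq_addr/= addKn lt_min => /andP[].
Qed.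

(* Regularity of the weak topology lets a filter on the weak closure of [B] be replaced by one on [B]. *)
Lemma rel_weak_compact_filters (B : set V) : B `<=` P ->
  (forall F : set_system V, ProperFilter F -> F B ->
    exists p, P p /\ forall U Q, F U -> weak_nbhd (dual_on P N) p Q ->
      exists u, U u /\ Q u) ->
  rel_weak_compact P N B.
Proof.
move=> BP Bclust F FF FK.
(* [S (U, W)] collects the points of [B] that are [W]-close to some point of [U]; these sets
   generate a filter on [B] whose weak cluster points are cluster points of [F]. *)
pose D (i : set V * set (V * V)) := F i.1 /\ weak_entourage i.2.
pose S (i : set V * set (V * V)) := [set b | B b /\ exists2 k, i.1 k & i.2 (b, k)].
have DT : weak_entourage setT by exists 0%N, (fun _ _ => 0), 1; split.
have FS : ProperFilter (filter_from D S).
  apply: filter_from_proper; last first.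
    move=> [U W] [/= FU [n [fs [e [fsP e0 We]]]]].
    have [k [Uk [Pk Kk]]] := filter_ex (filterI FU FK).
    have [|b [Bb bk]] := Kk [set u | forall i, (i < n)%N -> `|fs i u - fs i k| < e].
      by exists n, fs, e.
    by exists b; split=> //; exists k => //=; exact: We.
  apply: filter_from_filter; first by exists (setT, setT); split=> //; exact: filterT.
  move=> [U1 W1] [U2 W2] [/= FU1 W1P] [/= FU2 W2P].
  exists (U1 `&` U2, W1 `&` W2).
    by split; [exact: filterI|exact: weak_entourageI].
  by move=> b [Bb [k [Uk1 Uk2] [W1k W2k]]]; split; split=> //; exists k.
have [|p [Pp pclust]] := Bclust _ FS.
  by exists (setT, setT) => [|b []//]; split=> //; exact: filterT.
exists p; split.
  split=> // Q pQ; have [|b [Bb Qb]] := pclust B Q _ pQ; last by exists b.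
  by exists (setT, setT) => [|? []//]; split=> //; exact: filterT.
move=> U Q FU [n [fs [e [fsP e0 Qe]]]].
pose W := [set uv : V * V | forall i, (i < n)%N -> `|fs i uv.1 - fs i uv.2| < e / 2].
have e20 : 0 < e / 2 by rewrite divr_gt0.
have [||b [[Bb [k Uk bk]] pb]] := pclust (S (U, W))
    [set b | forall i, (i < n)%N -> `|fs i b - fs i p| < e / 2].
- by exists (U, W) => //; split=> //; exists n, fs, (e / 2).
- by exists n, fs, (e / 2).
exists k; split=> //; apply: Qe => i ilt.
rewrite -(subrKA (fs i b)) (le_lt_trans (ler_normD _ _))// [e in _ < e]splitr.
by rewrite ltrD ?pb// distrC; exact: bk.
Qed.

End WeakCompactness.

Section UltraLimit.
Context (R : realType) (T : Type) (G : set_system T).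
Hypothesis UG : UltraFilter G.

Lemma ultra_fmap (U : Type) (f : T -> U) : UltraFilter (f @ G).
Proof.
split=> [|H FH GH]; first exact: fmap_proper_filter.
apply/seteqP; split=> // A HA.
have [//|GnA] := in_ultra_setVsetC (f @^-1` A) UG.
have /filter_ex[x [//]] : H (A `&` ~` A) by apply: filterI => //; exact: GH.
Qed.

Lemma ultra_bounded_cvg (f : T -> R) M :
  G [set x | `|f x| <= M] -> f @ G --> lim (f @ G).
Proof.
move=> GM; have := @segment_compact R (- M) M; rewrite compact_ultra.
move=> /(_ (f @ G) (ultra_fmap f)) -[|l [_ fl]]; last by apply/cvg_ex; exists l.
have GM' : (f @ G) [set y | `|y| <= M] by exact: GM.
by apply: filterS GM' => y; rewrite /= in_itv/= -ler_norml.
Qed.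

End UltraLimit.

(** * Weakly null bounded sequences *)

Section FiniteIntersections.
Context (R : realType) (mu : set nat -> R) (C : R).
Hypothesis mu0 : mu set0 = 0.
Hypothesis le_mu : forall A B, A `<=` B -> mu A <= mu B.
Hypothesis muU : forall A B, mu (A `|` B) <= mu A + mu B.
Hypothesis mu_disjointU : forall A B, A `&` B = set0 -> mu A + mu B <= mu (A `|` B).
Hypothesis mu_bounded : forall A, mu A <= C.

(** Adding to a union [S] a set that meets it in measure below eta / 2 raises the measure by at
    least eta / 2; [K] such additions would exceed the bound [C]. *)
Lemma frequently_intersecting (A : nat -> set nat) (M : set nat) eta : 0 < eta ->
  (forall n, exists2 m, (n <= m)%N & M m) -> (forall n, M n -> eta <= mu (A n)) ->
  exists n, M n /\ exists2 eta', 0 < eta' &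
    forall k, exists2 m, (k <= m)%N & M m /\ eta' <= mu (A n `&` A m).
Proof.
move=> eta0 Minf Aeta; apply: contrapT => /forallNP small.
have {}small n e : M n -> 0 < e ->
    exists k, forall m, (k <= m)%N -> M m -> mu (A n `&` A m) < e.
  move=> Mn e0; apply: contrapT => /forallNP big; apply: (small n); split=> //.
  exists e => // k; apply: contrapT => /forall2NP nobig; apply: (big k) => m km Mm.
  have [//|/not_andP[//|/negP]] := nobig m.
  by rewrite -ltNge.
(* otherwise unions of nearly disjoint sets would have unbounded measure *)
have [K CK] : exists K : nat, C < K%:R * (eta / 2).
  exists (Num.truncn (C / (eta / 2))).+1; rewrite -ltr_pdivrMr ?divr_gt0//.
  exact: truncnS_gt.
suff [S [_ KS]] : exists S, (forall e, 0 < e ->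
    exists k, forall m, (k <= m)%N -> M m -> mu (S `&` A m) < e) /\
    K%:R * (eta / 2) <= mu S.
  by have := mu_bounded S; lra.
elim: K {CK} => [|K [S [Ssmall KS]]].
  exists set0; split; last by rewrite mul0r mu0.
  by move=> e e0; exists 0%N => m _ _; rewrite set0I mu0.
have [k kS] := Ssmall _ (divr_gt0 eta0 (ltr0n _ 2)).
have [n kn Mn] := Minf k.
exists (S `|` A n); split.
  move=> e e0; have e20 : 0 < e / 2 by rewrite divr_gt0.
  have [k1 k1P] := Ssmall _ e20; have [k2 k2P] := small _ _ Mn e20.
  exists (maxn k1 k2) => m; rewrite geq_max => /andP[k1m k2m] Mm.
  rewrite setIUl (le_lt_trans (muU _ _))// [e in _ < e]splitr ltrD//.
    exact: k1P.
  exact: k2P.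
have -> : S `|` A n = S `|` (A n `\` S) by rewrite setUDr setDv setD0.
apply: le_trans (mu_disjointU _); last by rewrite setIC setDKI.
rewrite -natr1 mulrDl mul1r lerD//.
have : mu (A n) <= mu (S `&` A n) + mu (A n `\` S).
  by apply: le_trans (muU _ _); apply: le_mu => x Ax; have [Sx|Sx] := pselect (S x); [left|right].
have := kS _ kn Mn; have := Aeta _ Mn; lra.
Qed.

(** [frequently_intersecting] is iterated on the traces of the [A m] on the current intersection.
    The lower bound on their measures may shrink at each step but stays positive, so every
    intersection is nonempty and supplies a point [k_ j] lying in all sets chosen so far. *)
Lemma finite_intersections (A : nat -> set nat) (M : set nat) eta : 0 < eta ->
  (forall n, exists2 m, (n <= m)%N & M m) -> (forall n, M n -> eta <= mu (A n)) ->
  exists n_ k_ : nat -> nat, (forall i, (i <= n_ i)%N) /\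
    forall i j, (i <= j)%N -> A (n_ i) (k_ j).
Proof.
move=> eta0 Minf Aeta.
(* A state (n, (B, N)) holds the last index chosen, the running intersection, and an infinite set of
   candidate indices whose sets meet [B] in measure at least some e > 0. *)
pose inv (s : nat * (set nat * set nat)) :=
  (forall n, exists2 m, (n <= m)%N & s.2.2 m) /\
  exists2 e, 0 < e & forall n, s.2.2 n -> e <= mu (s.2.1 `&` A n).
pose next (s t : {s | inv s}) := [/\ ((sval s).1 < (sval t).1)%N,
  (sval t).2.1 `<=` (sval s).2.1 & (sval t).2.1 `<=` A (sval t).1].
have step s : {t | next s t}.
  apply: cid; case: s => -[n [B N]] [/= Ninf [e e0 eN]].
  have [|m [Nm nm]|m [[nm Nm] [e' e'0 e'm]]] :=
    @frequently_intersecting (fun m => B `&` A m) [set m | (n < m)%N /\ N m] _ e0.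
  - move=> k; have [m] := Ninf (maxn k n.+1).
    by rewrite geq_max => /andP[km nm] Nm; exists m.
  - exact: eN.
  have invt : inv (m, (B `&` A m, [set l | N l /\ e' <= mu (B `&` A m `&` A l)])).
    split=> /= [k|].
      have [l kl [[_ Nl] le]] := e'm k; exists l => //; split=> //.
      by rewrite (le_trans le)// le_mu// => x [[Bx Ax] [_ Ax']].
    by exists e' => // l [].
  by exists (exist _ _ invt); split=> //= x [].
have inv0 : inv (0%N, (setT, M)).
  by split=> //=; exists eta => // n Mn; rewrite setTI; exact: Aeta.
have [f [_ fS]] := dependent_choice step (exist _ _ inv0).
have nonempty s : inv s -> s.2.1 !=set0.
  move=> [sinf [e e0 eA]]; have [m _ sm] := sinf 0%N.
  have /set0P[x [Bx _]] : s.2.1 `&` A m != set0.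
    by apply/eqP => sA0; have := eA _ sm; rewrite sA0 mu0; lra.
  by exists x.
(* The initial state has a dummy index 0 and intersection [setT], hence the shift to [i.+1]. *)
exists (fun i => (sval (f i.+1)).1), (fun j => get (sval (f j.+1)).2.1); split.
  by elim=> [//|i IHi]; case: (fS i.+1) => + _ _; exact: leq_ltn_trans.
move=> i j ij; case: (fS i) => _ _; apply.
have : (sval (f j.+1)).2.1 (get (sval (f j.+1)).2.1).
  by apply: getPex; apply: nonempty; exact: (svalP (f j.+1)).
elim: j ij (get _) => [|j IHj]; first by rewrite leqn0 => /eqP ->.
rewrite leq_eqVlt => /predU1P[-> //|/IHj sub] x fx; apply: sub.
by case: (fS j.+1) => _ + _; apply.
Qed.

End FiniteIntersections.

Section WeakNullBoundedSequences.
Context (R : realType).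

Definition bounded_seq (h : nat -> R) : Prop := exists M, forall k, `|h k| <= M.

Lemma bounded_seq_subspace : is_subspace (bounded_seq : set (nat -> R)).
Proof.
split=> [|a u v [M uM] [N vN]]; first by exists 0 => k; rewrite normr0.
exists (`|a| * M + N) => k; rewrite (le_trans (ler_normD _ _))// lerD//.
by rewrite normrM ler_wpM2l.
Qed.

Variables (psi : (nat -> R) -> R) (C : R).
Hypothesis psi_lin : lin_on bounded_seq (psi : (nat -> R) -> R^o).
Hypothesis C_gt0 : 0 < C.
Hypothesis psi_bounded : forall h M, (forall k, `|h k| <= M) -> `|psi h| <= C * M.

Let unit_on (A : set nat) (h : nat -> R) := forall k, `|h k| <= (k \in A)%:R.

Lemma unit_on_bounded A h : unit_on A h -> bounded_seq h.
Proof. by move=> hA; exists 1 => k; rewrite (le_trans (hA k))// lern1 leq_b1. Qed.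

(** The total variation of the finitely additive measure that represents [psi], obtained without
    constructing that measure. *)
Let mu (A : set nat) := sup [set r | exists2 h, unit_on A h & r = psi h].

Let unit_on0 A : unit_on A (0 : nat -> R).
Proof. by move=> k; rewrite normr0 ler0n. Qed.

Let psi0 : psi 0 = 0. Proof. exact: (lin_on0 bounded_seq_subspace psi_lin). Qed.

Let ubmu A : has_sup [set r | exists2 h, unit_on A h & r = psi h].
Proof.
split; first by exists 0, 0.
exists C => _ [h hA ->]; rewrite -[C]mulr1 (le_trans (ler_norm _))//.
by apply: psi_bounded => k; rewrite (le_trans (hA k))// lern1 leq_b1.
Qed.

Let psi_le A h : unit_on A h -> psi h <= mu A.
Proof. by move=> hA; apply: ub_le_sup; [case: (ubmu A)|exists h]. Qed.

Let mu_le A c : (forall h, unit_on A h -> psi h <= c) -> mu A <= c.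
Proof. by move=> hc; apply: ge_sup; [case: (ubmu A)|move=> _ [h hA ->]; exact: hc]. Qed.

(** When |psi (h n)| >= d, the part of [h n] with values at most eps in modulus contributes at most
    d / 2. Hence [mu] is bounded below on the sets where |h n| > eps, and [finite_intersections]
    applies to them. *)
Lemma weak_null_bounded_seqs (h : nat -> nat -> R) (M : R) :
  (forall n k, `|h n k| <= M) -> ~ ((fun n => psi (h n)) @ \oo --> (0 : R)) ->
  exists eps (n_ k_ : nat -> nat), [/\ 0 < eps, forall i, (i <= n_ i)%N &
    forall i j, (i <= j)%N -> eps < `|h (n_ i) (k_ j)|].
Proof.
move=> hM psih.
have [d d0 dpsi] : exists2 d, 0 < d &
    forall n, exists2 m, (n <= m)%N & d <= `|psi (h m)|.
  apply: contrapT => /forall2NP nod; apply: psih; apply/cvgr0Pnorm_lt => e e0.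
  have [//|/existsNP[n /forall2NP nn]] := nod e.
  exists n => // m /= nm; have [//|/negP] := nn m.
  by rewrite -ltNge.
(* Chosen so that C * eps = d / 2. *)
pose eps := d / 2 / C.
have eps0 : 0 < eps by rewrite !divr_gt0.
(* Division by [M'], a positive bound of all [h n], puts the restriction of [h n] to [A n] among the
   functions that define [mu (A n)]. *)
pose M' := Num.max M 1.
have M'0 : 0 < M' by rewrite lt_max ltr01 orbT.
pose A n := [set k | eps < `|h n k|].
pose cut (B : set nat) (u : nat -> R) k := (k \in B)%:R * u k.
have cut_bounded B u : bounded_seq u -> bounded_seq (cut B u).
  move=> [m um]; exists m => k; rewrite normrM normr_nat.
  by rewrite (le_trans _ (um k))// ler_piMl// lern1 leq_b1.
have cutU B D u : B `&` D = set0 -> cut (B `|` D) u = cut B u + cut D u.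
  move=> BD; apply/funext => k; rewrite /cut fctE -mulrDl; congr (_ * _).
  rewrite in_setU -natrD; have := in_setI k B D; rewrite BD in_set0.
  by case: (k \in B); case: (k \in D).
have cut1 B D u : unit_on D u -> unit_on (B `&` D) (cut B u).
  move=> uD k; rewrite normrM normr_nat in_setI -mulnb natrM.
  by apply: ler_pM.
have Amu n : d <= `|psi (h n)| -> d / 2 / M' <= mu (A n).
  move=> dn.
  have hb : bounded_seq (h n) by exists M => k.
  have hE : psi (h n) = psi (cut (A n) (h n)) + psi (cut (~` A n) (h n)).
    rewrite -(lin_onD psi_lin); [|exact: cut_bounded..].
    rewrite -cutU ?setICr// setUCr; congr psi; apply/funext => k.
    by rewrite /cut in_setT mul1r.
  have : `|psi (cut (~` A n) (h n))| <= d / 2.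
    have -> : d / 2 = C * eps by rewrite /eps; field; exact: lt0r_neq0.
    apply: psi_bounded => k; rewrite normrM normr_nat in_setC.
    have [|Ak] := boolP (k \in A n); first by rewrite mul0r ltW.
    by rewrite mul1r leNgt; apply: contra Ak => Ak; rewrite inE.
  have [s s1 ss] : exists2 s : R, `|s| <= 1 & s * psi (cut (A n) (h n)) = `|psi (cut (A n) (h n))|.
    exists (Num.sg (psi (cut (A n) (h n)))); last by rewrite normrEsg.
    by rewrite normr_sg lern1 leq_b1.
  have : `|psi (cut (A n) (h n))| / M' <= mu (A n).
    rewrite -ss mulrAC -(linfunZ bounded_seq_subspace _ psi_lin); last exact: cut_bounded.
    apply: psi_le => k.
    rewrite [X in `|X|](_ : _ = s / M' * ((k \in A n)%:R * h n k))//.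
    rewrite normrM (normrM (k \in A n)%:R) normr_nat mulrCA ler_piMr//.
    rewrite (normrM s) normfV (gtr0_norm M'0) mulrAC ler_pdivrMr// mul1r.
    by rewrite (le_trans (_ : _ <= `|h n k|)) ?ler_piMl// (le_trans (hM _ _))// le_max lexx.
  move=> /(le_trans _) + cle; apply; rewrite ler_pM2r ?invr_gt0//.
  have := ler_normD (psi (cut (A n) (h n))) (psi (cut (~` A n) (h n))).
  by rewrite -hE; lra.
have [||||||n_ [k_ [in_ Ank]]] := @finite_intersections R mu C _ _ _ _ _
    A [set n | d <= `|psi (h n)|] (d / 2 / M') _ dpsi Amu.
- apply/eqP; rewrite eq_le; apply/andP; split; last by rewrite -psi0 psi_le.
  apply: mu_le => u u0; rewrite -psi0 le_eqVlt; apply/orP; left; apply/eqP.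
  congr psi; apply/funext => k; apply/normr0_eq0/eqP.
  by rewrite eq_le normr_ge0 andbT; have := u0 k; rewrite in_set0.
- move=> B D BD; apply: mu_le => u uB; apply: psi_le => k.
  rewrite (le_trans (uB k))// ler_nat; have [/set_mem/BD/mem_set ->//|//] := boolP (k \in B).
- move=> B D; apply: mu_le => u uBD.
  have ub := unit_on_bounded uBD.
  have -> : u = cut B u + cut (D `\` B) u.
    rewrite -cutU ?setDKI//; last by rewrite setIC setDKI.
    rewrite setUDr setDv setD0; apply/funext => k; rewrite /cut.
    have := uBD k; case: (k \in B `|` D); first by rewrite mul1r.
    by rewrite normr_le0 => /eqP ->; rewrite mulr0.
  rewrite (lin_onD psi_lin); [|exact: cut_bounded..].
  rewrite lerD//; apply: psi_le => k; rewrite (le_trans (cut1 _ _ _ uBD k))// ler_nat.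
    by rewrite setIidl// => x; left.
  case: (boolP (k \in _)) => // /set_mem[[Dk _] _].
  by rewrite mem_set.
- move=> B D BD; rewrite -lerBrDr; apply: mu_le => u uB.
  rewrite lerBrDr addrC -lerBrDr; apply: mu_le => v vD.
  rewrite lerBrDr addrC -(lin_onD psi_lin); [|exact: unit_on_bounded uB|exact: unit_on_bounded vD].
  apply: psi_le => k; rewrite (le_trans (ler_normD _ _))// (le_trans (lerD (uB k) (vD k)))//.
  rewrite -natrD ler_nat in_setU; have := in_setI k B D; rewrite BD in_set0.
  by case: (k \in B); case: (k \in D).
- move=> B; apply: mu_le => u uB; rewrite -[C]mulr1 (le_trans (ler_norm _))//.
  by apply: psi_bounded => k; rewrite (le_trans (uB k))// lern1 leq_b1.
- by rewrite !divr_gt0.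
by exists eps, n_, k_; split.
Qed.

End WeakNullBoundedSequences.

(** * The Banach space l_1 *)

Lemma cvg_sumr (R : realType) (T : Type) (F : set_system T) n (f : 'I_n -> T -> R) (l : 'I_n -> R) :
  Filter F -> (forall i, f i @ F --> l i) ->
  (fun x => \sum_(i < n) f i x) @ F --> \sum_(i < n) l i.
Proof. by move=> FF fl; apply: cvg_big => //; exact: add_continuous. Qed.

Section L1.
Context (R : realType).
Implicit Types (u v : nat -> R) (M : R).

Lemma nondecreasing_series_norm u : nondecreasing_seq (series (fun k => `|u k|)).
Proof. exact: nondecreasing_series. Qed.

Lemma l1_bounded u M : (forall n, \sum_(k < n) `|u k| <= M) -> l1 u.
Proof.
move=> uM; apply: nondecreasing_is_cvgn; first exact: nondecreasing_series_norm.
by exists M => _ [n _ <-]; rewrite seriesEord; exact: uM.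
Qed.

Lemma l1norm_le u M : (forall n, \sum_(k < n) `|u k| <= M) -> l1norm u <= M.
Proof.
move=> uM; apply: limr_le; first exact: l1_bounded uM.
by apply: nearW => n; rewrite seriesEord; exact: uM.
Qed.

Lemma l1_sum_le u n : l1 u -> \sum_(k < n) `|u k| <= l1norm u.
Proof.
move=> lu; have := nondecreasing_cvgn_le (nondecreasing_series_norm u) lu n.
by rewrite {1}seriesEord.
Qed.

Lemma l1norm_ge0 u : l1 u -> 0 <= l1norm u.
Proof. by move=> /(l1_sum_le 0); rewrite big_ord0. Qed.

Lemma l1_coord_le u n : l1 u -> `|u n| <= l1norm u.
Proof.
move=> /(l1_sum_le n.+1); apply: le_trans; rewrite big_ord_recr lerDr.
by apply: sumr_ge0 => k _.
Qed.

Lemma l1normD u v : l1 u -> l1 v -> forall n, \sum_(k < n) `|(u + v) k| <= l1norm u + l1norm v.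
Proof.
move=> lu lv n; rewrite (le_trans _ (lerD (l1_sum_le n lu) (l1_sum_le n lv)))//.
by rewrite -big_split/= ler_sum// => k _; exact: ler_normD.
Qed.

Lemma l1normZ (a : R) u : l1 u -> forall n, \sum_(k < n) `|(a *: u) k| <= `|a| * l1norm u.
Proof.
move=> lu n; apply: le_trans (ler_wpM2l (normr_ge0 a) (l1_sum_le n lu)).
by rewrite mulr_sumr ler_sum// => k _; rewrite -normrM.
Qed.

Lemma l1_0 n : \sum_(k < n) `|(0 : nat -> R) k| <= 0.
Proof. by rewrite big1// => k _; rewrite normr0. Qed.

Lemma l1_subspace : is_subspace (@l1 R).
Proof.
split=> [|a u v lu lv]; first exact: l1_bounded l1_0.
by apply: l1_bounded; apply: l1normD => //; apply: l1_bounded; exact: l1normZ.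
Qed.

Definition l1_unit n : nat -> R := fun k => (k == n)%:R.

Lemma l1_unit_sum n m : \sum_(k < m) `|l1_unit n k| <= 1.
Proof.
have [nm|nm] := ltnP n m.
  rewrite (bigD1 (Ordinal nm))//= /l1_unit eqxx normr1 big1 ?addr0// => k kn.
  by rewrite -val_eqE/= in kn; rewrite (negbTE kn) normr0.
rewrite big1// => k _; rewrite /l1_unit ltn_eqF ?normr0//.
exact: leq_trans nm.
Qed.

End L1.

(** l_1 as a type of its own: condition (2) and Banach-Steinhaus speak of complete normed modules,
    not of subspaces of nat -> R. *)
Record ell1 (R : realType) := Ell1 { ell1_val :> nat -> R; ell1_mem : ell1_val \in @l1 R }.

Section Ell1.
Context (R : realType).

HB.instance Definition _ := [isSub for @ell1_val R].
HB.instance Definition _ := [Choice of ell1 R by <:].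

Lemma l1_submod_closed : submod_closed (mem (@l1 R) : {pred nat -> R}).
Proof.
have [l0 lD] := l1_subspace R.
split=> [|a u v]; first exact/mem_set.
by move=> /set_mem lu /set_mem lv; apply/mem_set; exact: lD.
Qed.

HB.instance Definition _ := GRing.SubChoice_isSubLmodule.Build R (nat -> R)
  (mem (@l1 R)) (ell1 R) (GRing.submod_closed_semi l1_submod_closed).

Implicit Types u v : ell1 R.

Lemma ell1P u : l1 u. Proof. exact/set_mem/(valP u). Qed.
Arguments ell1P u : clear implicits.

Lemma ell1_valD u v : ell1_val (u + v) = (u : nat -> R) + (v : nat -> R).
Proof. exact: (raddfD (val : ell1 R -> nat -> R)). Qed.

Lemma ell1_valZ (a : R) u : ell1_val (a *: u) = a *: (u : nat -> R).
Proof. exact: (linearZ_LR (val : ell1 R -> nat -> R)). Qed.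

Let nrm u : R := l1norm u.

Let nrmD u v : nrm (u + v) <= nrm u + nrm v.
Proof. by rewrite /nrm ell1_valD; apply: l1norm_le; exact: l1normD (ell1P u) (ell1P v). Qed.

Let nrmZ (a : R) u : nrm (a *: u) = `|a| * nrm u.
Proof.
have le b w : nrm (b *: w) <= `|b| * nrm w.
  by rewrite /nrm ell1_valZ; apply: l1norm_le; exact: l1normZ (ell1P w).
apply/eqP; rewrite eq_le le/=.
have [->|a0] := eqVneq a 0.
  by rewrite normr0 mul0r; exact: l1norm_ge0 (ell1P _).
have := le a^-1 (a *: u); rewrite scalerA mulVf// scale1r normfV.
by rewrite ler_pdivlMl// normr_gt0.
Qed.

Let nrm0 u : nrm u = 0 -> u = 0.
Proof.
move=> u0; apply/val_inj/funext => k; apply/normr0_eq0/eqP.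
by rewrite eq_le normr_ge0 andbT -u0; exact: l1_coord_le (ell1P u).
Qed.

HB.instance Definition _ := @Lmodule_isNormed.Build R (ell1 R) nrm nrmD nrmZ nrm0.

(** The limit is taken coordinatewise. A bound on l_1 distances passes to the limit in each finite
    partial sum, which shows both that the limit is summable and that the filter converges to it in
    norm. *)
Lemma ell1_complete (F : set_system (ell1 R)) : ProperFilter F -> cauchy F -> cvg F.
Proof.
move=> FF Fc.
have near_diam e : 0 < e -> exists2 A, F A & forall u v, A u -> A v -> `|u - v| <= e.
  move=> e0; have e20 : 0 < e / 2 by rewrite divr_gt0.
  have [x Fx] := (cauchyP _).1 Fc _ e20.
  exists (ball x (e / 2)) => // u v; rewrite -!ball_normE /= => xu xv.
  by rewrite -(subrKA x) (le_trans (ler_normD _ _))// [leRHS]splitr lerD// ltW// distrC.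
have coord k : exists l, (fun u : ell1 R => u k) @ F --> (l : R).
  apply/cvg_ex; apply: R_complete; apply: cauchy_exP => e e0.
  have e20 : 0 < e / 2 by rewrite divr_gt0.
  have [A FA Ae] := near_diam _ e20; have [u Au] := filter_ex FA.
  exists (u k); apply: (@filterS _ F _ A) => // v Av.
  rewrite -ball_normE /= (@le_lt_trans _ _ (e / 2))// ?ltr_pdivrMr ?ltr_pMr// ?ltr1n//.
  by rewrite (le_trans _ (Ae u v Au Av))//; exact: l1_coord_le (ell1P (u - v)).
have [p pP] := choice coord.
have limsum e A (u : ell1 R) : (forall v, A v -> `|v - u| <= e) -> F A ->
    forall n, \sum_(k < n) `|(p - u) k| <= e.
  move=> Ae FA n; apply: (@cvgr_to_le _ F _ _ (fun v : ell1 R => \sum_(k < n) `|v k - u k|)).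
    apply: cvg_sumr => k; apply: cvg_norm; apply: cvgB; [exact: pP|exact: cvg_cst].
  apply: (@filterS _ F _ A) => // v /Ae; apply: le_trans.
  exact: l1_sum_le (ell1P (v - u)).
have lp : l1 p.
  have [A FA Ae] := near_diam _ (ltr01 : 0 < 1 :> R); have [u Au] := filter_ex FA.
  have -> : p = (u : nat -> R) + (p - (u : nat -> R)) by rewrite addrC subrK.
  apply: (subspaceD (l1_subspace R)); first exact: ell1P.
  by apply: (l1_bounded (M := 1)); apply: (limsum _ A) => // v Av; exact: Ae.
apply/cvg_ex; exists (Ell1 (mem_set lp)); apply/cvgrPdist_le => e e0.
have [A FA Ae] := near_diam _ e0.
apply: (@filterS _ F _ A) => // u Au; apply: l1norm_le.
by apply: (limsum _ A) => // v Av; exact: Ae.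
Qed.

HB.instance Definition _ := Uniform_isComplete.Build (ell1 R) ell1_complete.

End Ell1.

Arguments ell1P {R} u.

(** * Dual and bidual *)

Section HahnBanachPoint.
Context (R : realType) (V : lmodType R) (p : V -> R).
Hypothesis pD : forall u v, p (u + v) <= p u + p v.
Hypothesis pZ : forall a u, 0 < a -> p (a *: u) = a * p u.

Lemma subspaceT : is_subspace [set: V]. Proof. by []. Qed.

Lemma sublinear0 : p 0 = 0.
Proof. by have := pZ 0 (ltr0n R 2); rewrite scaler0; lra. Qed.

(** This is the domination on a line needed for [hahn_banach_point]; for a < 0 it comes from 0 = p 0
    <= p (a u) + p (- a u). *)
Lemma sublinearZ_ge a u : a * p u <= p (a *: u).
Proof.
have [a0|a0|->] := ltgtP a 0; last by rewrite mul0r scale0r sublinear0.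
  have := pD (a *: u) (- a *: u); rewrite -scalerDl subrr scale0r sublinear0.
  by rewrite (@pZ (- a)) ?oppr_gt0//; lra.
by rewrite pZ.
Qed.

Lemma hahn_banach_point x : exists h : V -> R,
  [/\ lin_on setT (h : V -> R^o), h x = p x & forall u, h u <= p u].
Proof.
(* The coefficient of a vector along [x] is determined only when [x] is nonzero. *)
have [x0|x0] := eqVneq x 0.
  have [|||||u ->|h [hl h0 hp]] := @hahn_banach R V setT p subspaceT _ _ [set 0] (fun=> 0).
  - by move=> u v _ _; exact: pD.
  - by move=> a u a0 _; exact: pZ.
  - by split=> // a u v -> ->; rewrite scaler0 addr0.
  - by [].
  - by move=> a u v _ _ /=; rewrite scaler0 addr0.
  - by rewrite sublinear0.
  - exists h; split=> //; first by rewrite x0 h0// sublinear0.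
    by move=> u; exact: hp.
pose g u := get [set t : R | u = t *: x] * p x.
have gE t : g (t *: x) = t * p x.
  congr (_ * _); have /eqP := getPex (ex_intro (fun s : R => t *: x = s *: x) t erefl).
  rewrite -subr_eq0 -scalerBl scaler_eq0 (negbTE x0) orbF.
  by rewrite subr_eq0 => /eqP <-.
have [|||||u [t _ <-]|h [hl hg hp]] :=
  @hahn_banach R V setT p subspaceT _ _ (range (fun t : R => t *: x)) g.
- by move=> u v _ _; exact: pD.
- by move=> a u a0 _; exact: pZ.
- split; first by exists 0 => //; rewrite scale0r.
  by move=> a _ _ [t _ <-] [s _ <-]; exists (a * t + s) => //; rewrite scalerDl scalerA.
- by [].
- move=> a _ _ [t _ <-] [s _ <-] /=.
  by rewrite scalerA -scalerDl !gE mulrDl -mulrA.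
- by rewrite gE; exact: sublinearZ_ge.
- exists h; split=> //; last by move=> u; exact: hp.
  by rewrite hg; [rewrite -[x in g x]scale1r gE mul1r|exists 1 => //; rewrite scale1r].
Qed.

End HahnBanachPoint.

Section DualNorm.
Context (R : realType) (V : lmodType R) (P : set V) (N : V -> R).
Hypothesis N_ge0 : forall u, P u -> 0 <= N u.

Lemma dual_on_subspace : is_subspace (dual_on P N : set (V -> R)).
Proof.
split.
  split; first by move=> a u v _ _; rewrite scaler0 addr0.
  by exists 0 => u _; rewrite normr0 mul0r.
move=> a f g [fl [C fC]] [gl [D gD]]; split.
  apply/linfunP => b u v Pu Pv.
  rewrite !fct_combE ((linfunP _ _).1 fl)// ((linfunP _ _).1 gl)//.
  ring.
exists (`|a| * C + D) => u Pu; rewrite fct_combE.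
by rewrite (le_trans (ler_normD _ _))// mulrDl lerD ?gD// normrM -mulrA ler_wpM2l// fC.
Qed.

Lemma dual_norm_le f c : (exists u, P u /\ N u <= 1) ->
  (forall u, P u -> N u <= 1 -> `|f u| <= c) -> dual_norm P N f <= c.
Proof.
move=> [u [Pu Nu]] fc; apply: ge_sup; first by exists `|f u|, u.
by move=> _ [v [Pv Nv ->]]; exact: fc.
Qed.

Lemma dual_norm_ge f u : dual_on P N f -> P u -> N u <= 1 -> `|f u| <= dual_norm P N f.
Proof.
move=> [_ [C fC]] Pu Nu; apply: ub_le_sup; last by exists u.
exists (Num.max C 0) => _ [v [Pv Nv ->]].
rewrite (le_trans (fC _ Pv))// (@le_trans _ _ (Num.max C 0 * N v))//.
  by rewrite ler_wpM2r ?N_ge0// le_max lexx.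
by rewrite ler_piMr// le_max lexx orbT.
Qed.

(** Elements of [dual_on P N] are functions on all of V, so two of them may represent the same
    functional on [P] and still differ. Their difference has dual norm 0, and a bounded [Psi] cannot
    separate them. *)
Lemma functional_ext_on f g C Psi :
  dual_on P N f -> dual_on P N g -> (exists u, P u /\ N u <= 1) ->
  lin_on (dual_on P N) (Psi : (V -> R) -> R^o) ->
  (forall f, dual_on P N f -> `|Psi f| <= C * dual_norm P N f) ->
  (forall u, P u -> f u = g u) -> Psi f = Psi g.
Proof.
move=> Df Dg P1 Psil PsiC fg.
have Dfg := subspaceB dual_on_subspace Df Dg.
apply/eqP; rewrite -subr_eq0 -[_ - _](lin_onB dual_on_subspace Psil Df Dg) -normr_le0.
have dn0 : dual_norm P N (f - g) = 0.
  apply/eqP; rewrite eq_le; apply/andP; split.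
    by apply: dual_norm_le => // u Pu _; rewrite fct_subE fg// subrr normr0.
  have [u [Pu Nu]] := P1.
  by apply: le_trans (dual_norm_ge Dfg Pu Nu).
by rewrite (le_trans (PsiC _ Dfg))// dn0 mulr0.
Qed.

End DualNorm.

Lemma filter_forall_lt (T : Type) (F : set_system T) (FF : Filter F) n (B : nat -> set T) :
  (forall i, (i < n)%N -> F (B i)) -> F [set x | forall i, (i < n)%N -> B i x].
Proof.
elim: n => [|n IHn] FB; first by apply: filterS filterT.
have /IHn FBn : forall i, (i < n)%N -> F (B i) by move=> i /ltnW; exact: FB.
apply: filterS (filterI FBn (FB n (ltnSn n))) => x [Bx Bnx] i.
by rewrite ltnS leq_eqVlt => /predU1P[->//|/Bx].
Qed.

Section Bidual.
Context (R : realType) (E : completeNormedModType R).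
Local Notation D := (@Edual R E).

Definition contractive (f : E -> R) : Prop := D f /\ forall x, `|f x| <= `|x|.

Lemma Edual_subspace : is_subspace (D : set (E -> R)).
Proof. exact: dual_on_subspace. Qed.

Lemma norming_functional (x : E) : exists2 f, contractive f & f x = `|x|.
Proof.
have [|a u a0|f [fl fx fn]] := @hahn_banach_point R E (fun x => `|x|) _ _ x.
- exact: ler_normD.
- by rewrite normrZ gtr0_norm.
have fc u : `|f u| <= `|u|.
  rewrite ler_norml fn andbT lerNl -normrN.
  by have := fn (- u); rewrite (lin_onN (subspaceT E) fl).
by exists f => //; split=> //; split=> //; exists 1 => u _; rewrite mul1r.
Qed.

Lemma Edual_scale_contractive f : D f -> exists2 c : R, 0 < c & contractive (c *: f).
Proof.
move=> Df; have [_ [C fC]] := Df.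
pose c := (Num.max C 1)^-1.
have c0 : 0 < c by rewrite invr_gt0 lt_max ltr01 orbT.
exists c => //; split; first exact: (subspaceZ Edual_subspace).
move=> x; rewrite fct_scaleE normrM gtr0_norm// ler_pdivrMl ?lt_max ?ltr01 ?orbT//.
by rewrite (le_trans (fC x I))// ler_wpM2r// le_max lexx.
Qed.

(** Induction on [s]. If some [v] in the dual kills [s] but not [a], correcting each [f] by a
    multiple of [v] makes it vanish at [a], and a multiple of [a] is added to the point at the end;
    if there is no such [v], vanishing on [s] already implies vanishing at [a]. *)
Lemma eval_of_annihilator (s : seq E) (X : (E -> R) -> R) :
  lin_on D (X : (E -> R) -> R^o) ->
  (forall f, D f -> (forall a, a \in s -> f a = 0) -> X f = 0) ->
  exists e, forall f, D f -> X f = f e.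
Proof.
elim: s X => [|a s IHs] X Xl X0.
  exists 0 => f Df; rewrite X0//; case: Df => fl _.
  by rewrite (lin_on0 (subspaceT E) fl).
have [[v [Dv vs va]]|nov] :=
  pselect (exists v, [/\ D v, forall b, b \in s -> v b = 0 & v a <> 0]); last first.
  apply: IHs => // f Df fs; apply: X0 => // b; rewrite inE => /predU1P[->|/fs//].
  by apply: contrapT => fa; apply: nov; exists f.
have [||e eP] := IHs (fun f => X f - f a / v a * X v).
- apply/linfunP => b f g Df Dg; rewrite ((linfunP _ _).1 Xl)//.
  by rewrite fct_combE /=; ring.
- move=> f Df fs; have Dw : D (f - (f a / v a) *: v).
    by apply: (subspaceB Edual_subspace) => //; exact: (subspaceZ Edual_subspace).
  rewrite -(linfunZ Edual_subspace _ Xl Dv).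
  rewrite -[_ - _](lin_onB Edual_subspace Xl Df); last exact: (subspaceZ Edual_subspace).
  apply: X0 => // b; rewrite fct_subE fct_scaleE inE => /predU1P[->|bs].
    by rewrite divfK ?subrr//; exact/eqP.
  by rewrite (fs b)// (vs b)// mulr0 subr0.
exists (e + (X v / v a) *: a) => f Df.
have [fl _] := Df.
rewrite (lin_onD fl)// (linfunZ (subspaceT E) _ fl)// -eP//.
by field; exact/eqP.
Qed.

(** A Banach space is norm closed in its bidual: points approximating [X] within 1/(n+1) on the dual
    ball form a Cauchy sequence, because contractive functionals attain the norm, and [X] is
    evaluation at the limit. *)
Lemma bidual_closed (X : (E -> R) -> R) : lin_on D (X : (E -> R) -> R^o) ->
  (forall d, 0 < d -> exists e, forall f, contractive f -> `|X f - f e| <= d) ->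
  exists e, forall f, D f -> X f = f e.
Proof.
move=> Xl Xe.
have [e_ eP] : {e_ : nat -> E & forall n f, contractive f -> `|X f - f (e_ n)| <= n.+1%:R^-1}.
  apply: (choice (P := fun n e => forall f, contractive f -> `|X f - f e| <= n.+1%:R^-1)) => n.
  by apply: Xe; rewrite invr_gt0.
have dist n m : `|e_ n - e_ m| <= n.+1%:R^-1 + m.+1%:R^-1.
  have [f fc <-] := norming_functional (e_ n - e_ m); have [[fl _] _] := fc.
  rewrite (lin_onB (subspaceT E) fl)// (le_trans (ler_norm _))//.
  rewrite -(subrKA (X f)) (le_trans (ler_normD _ _))// lerD ?eP//.
  by rewrite distrC eP.
have ee : cvgn e_.
  apply: (cauchy_cvg (e_ @ \oo)); apply: cauchy_exP => eps eps0.
  have e20 : 0 < eps / 2 by rewrite divr_gt0.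
  have [n _ nP] := near_infty_natSinv_lt (PosNum e20).
  exists (e_ n); exists n => // m /= nm; rewrite -ball_normE /=.
  rewrite (le_lt_trans (dist _ _))// [ltRHS]splitr ltrD//; [exact: (nP n) (leqnn n)|exact: nP].
set e := limn e_ in ee.
have Xc f : contractive f -> X f = f e.
  move=> fc; apply/eqP; rewrite -subr_eq0 -normr_le0; apply/ler_addgt0Pr => eps eps0.
  have e20 : 0 < eps / 2 by rewrite divr_gt0.
  have [n _ nP] := near_infty_natSinv_lt (PosNum e20).
  have /cvgrPdist_le/(_ _ e20)[m _ mP] := ee.
  rewrite add0r -(subrKA (f (e_ (maxn n m)))) (le_trans (ler_normD _ _))// [leRHS]splitr lerD//.
    by rewrite (le_trans (eP _ _ fc))// ltW//; apply: nP => /=; exact: leq_maxl.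
  have [[fl _] fb] := fc.
  rewrite -(lin_onB (subspaceT E) fl)// (le_trans (fb _))// distrC; apply: mP => /=.
  exact: leq_maxr.
exists e => f Df; have [c c0 cf] := Edual_scale_contractive Df.
have := Xc _ cf; rewrite (linfunZ Edual_subspace _ Xl Df) fct_scaleE.
by apply: mulfI; rewrite gt_eqF.
Qed.

End Bidual.

(** * The Eberlein-Smulian theorem *)

Section UltraLimitOfFunctionals.
Context (R : realType) (T : Type) (G : set_system T) (V : lmodType R) (P : set V).
Hypotheses (UG : UltraFilter G) (subP : is_subspace P).
Variable phi : T -> V -> R.
Hypothesis phi_lin : forall t, lin_on P (phi t : V -> R^o).
Hypothesis phi_bounded : forall v, P v -> exists M, G [set t | `|phi t v| <= M].

(** A substitute for Alaoglu's theorem: applied to evaluations it yields elements of a bidual,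
    applied to functionals on a space it yields elements of the dual. *)
Definition ultra_lim v := lim ((fun t => phi t v) @ G).

Lemma ultra_lim_cvg v : P v -> (fun t => phi t v) @ G --> ultra_lim v.
Proof. by move=> /phi_bounded[M]; exact: ultra_bounded_cvg. Qed.

Lemma ultra_lim_lin : lin_on P (ultra_lim : V -> R^o).
Proof.
apply/linfunP => a u v Pu Pv; apply: cvg_lim => //.
have -> : (fun t => phi t (a *: u + v)) = (fun t => a * phi t u + phi t v).
  by apply/funext => t; rewrite ((linfunP _ _).1 (@phi_lin t)).
apply: cvgD; last exact: ultra_lim_cvg.
by apply: cvgMl_tmp; exact: ultra_lim_cvg.
Qed.

Lemma ultra_lim_le v c : P v -> G [set t | `|phi t v| <= c] -> `|ultra_lim v| <= c.
Proof.
move=> Pv Gc; apply: (cvgr_to_le (cvg_norm (ultra_lim_cvg Pv))).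
exact: Gc.
Qed.

End UltraLimitOfFunctionals.

Section EberleinSmulian.
Context (R : realType) (E : completeNormedModType R).
Local Notation D := (@Edual R E).

Let N1 : exists u : E, [set: E] u /\ `|u| <= 1.
Proof. by exists 0; rewrite normr0. Qed.

Let nN : forall u : E, [set: E] u -> 0 <= `|u|. Proof. by []. Qed.

Local Notation dnorm := (dual_norm [set: E] (@Num.norm R E)).

Lemma dual_norm_contractive f : contractive f -> dnorm f <= 1.
Proof. by move=> [_ fc]; apply: dual_norm_le => // u _; exact: le_trans. Qed.

Lemma le_dual_norm f x : D f -> `|f x| <= dnorm f * `|x|.
Proof.
move=> Df; have [fl _] := Df.
have [->|x0] := eqVneq x 0; first by rewrite (lin_on0 (subspaceT E) fl) !normr0 mulr0.
have := @dual_norm_ge _ _ _ _ nN f (`|x|^-1 *: x) Df I.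
rewrite normrZ normfV normr_id mulVf ?normr_eq0// => /(_ (lexx _)).
rewrite (linfunZ (subspaceT E) _ fl)// normrM normfV normr_id.
by rewrite ler_pdivrMl ?normr_gt0// mulrC.
Qed.

Lemma dual_normD f g : D f -> D g -> dnorm (f + g) <= dnorm f + dnorm g.
Proof.
move=> Df Dg; apply: dual_norm_le => // u _ u1.
by rewrite (le_trans (ler_normD _ _))// lerD// dual_norm_ge.
Qed.

Lemma dual_normZ a f : 0 < a -> D f -> dnorm (a *: f) = a * dnorm f.
Proof.
have le b g : 0 < b -> D g -> dnorm (b *: g) <= b * dnorm g.
  move=> b0 Dg; apply: dual_norm_le => // u _ u1.
  by rewrite fct_scaleE normrM gtr0_norm// ler_pM2l// dual_norm_ge.
move=> a0 Df; apply/eqP; rewrite eq_le le//= -ler_pdivlMl//.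
rewrite -[f in leLHS](scalerK (lt0r_neq0 a0)) le ?invr_gt0//.
exact: (subspaceZ (@Edual_subspace R E)).
Qed.

(** Otherwise X <= d * dnorm on the annihilator [W] of [s]. A Hahn-Banach extension [Z] of X
    restricted to [W] keeps this bound, and X - Z, which kills [W], is evaluation at some [e] by
    [eval_of_annihilator]. Then |X f - f e| = |Z f| <= d on the dual ball, against the assumed
    distance. *)
Lemma helly (X : (E -> R) -> R) (d : R) (s : seq E) : 0 <= d ->
  lin_on D (X : (E -> R) -> R^o) ->
  (forall e, exists2 f, contractive f & d < `|X f - f e|) ->
  exists f, [/\ contractive f, forall a, a \in s -> f a = 0 & d < X f].
Proof.
move=> d0 Xl far; apply: contrapT => /forallNP nof.
pose W := [set f | D f /\ forall a, a \in s -> f a = 0].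
have subD := @Edual_subspace R E.
have subW : is_subspace W.
  split; first by split; [exact: subspace0|].
  move=> a f g [Df fs] [Dg gs]; split; first by case: subD => _; apply.
  by move=> b bs; rewrite fct_combE fs// gs// mulr0 addr0.
have XW f : W f -> X f <= d * dnorm f.
  move=> Wf; have [Df fs] := Wf.
  have [f0|f0] := eqVneq (dnorm f) 0.
    have -> : f = 0.
      apply/funext => x; apply/eqP; rewrite -normr_le0.
      by rewrite (le_trans (le_dual_norm x Df))// f0 mul0r.
    rewrite (lin_on0 subD Xl) mulr_ge0//.
    apply: le_trans (@dual_norm_ge _ _ _ _ nN _ 0 _ _ _); rewrite ?normr0//.
    exact: subspace0.
  have fp : 0 < dnorm f.
    by rewrite lt_neqAle eq_sym f0; apply: le_trans (@dual_norm_ge _ _ _ _ nN f 0 Df _ _); rewrite ?normr0.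
  have cf : contractive ((dnorm f)^-1 *: f).
    split; first exact: subspaceZ.
    move=> x; rewrite fct_scaleE normrM normfV (gtr0_norm fp) ler_pdivrMl//.
    exact: le_dual_norm.
  rewrite leNgt; apply/negP => Xf; apply: (nof ((dnorm f)^-1 *: f)); split=> //.
    by move=> a /fs fa; rewrite fct_scaleE fa mulr0.
  by rewrite (linfunZ subD _ Xl Df) ltr_pdivlMl// mulrC.
have [|a f a0 Df|f []||Z [Zl ZX Zd]] :=
  @hahn_banach R (E -> R) D (fun f => d * dnorm f) subD _ _ W X subW _ _ XW.
- by move=> f g Df Dg; rewrite -mulrDr ler_wpM2l// dual_normD.
- by rewrite dual_normZ// mulrCA.
- by [].
- by move=> a f g [Df _] [Dg _]; exact: Xl.
have [||e eP] := @eval_of_annihilator R E s (fun f => X f - Z f).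
- apply/linfunP => a f g Df Dg.
  by rewrite ((linfunP _ _).1 Xl)// ((linfunP _ _).1 Zl)//; ring.
- by move=> f Df fs; rewrite ZX ?subrr.
have [f fc] := far e; have [Df _] := fc.
rewrite -eP// opprB addrC subrK ltNge => /negP; apply.
have dc g : contractive g -> Z g <= d.
  move=> gc; have [Dg _] := gc; rewrite (le_trans (Zd _ Dg))//.
  by rewrite ler_piMr// dual_norm_contractive.
rewrite ler_norml dc// andbT lerNl -[- Z f](lin_onN subD Zl Df); apply: dc.
by split; [exact: subspaceN|move=> x; rewrite [(- f) x]/(- f x) normrN; case: fc].
Qed.

(** If the limit [X] of evaluations were not an evaluation, it would stay at distance more than some
    d > 0 from all of them. [helly] then gives f_n and a_n in [A] with f_n (a_m) = 0 for m < n and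
    f_n (a_m) > d / 2 for m >= n. A weak cluster point p of (a_m) has f_n p >= d / 2 for all n; an
    ultrafilter limit f of the f_n vanishes at every a_m although f p >= d / 2, a contradiction. *)
Lemma eberlein_smulian (A : set E) (M : R) : (forall x, A x -> `|x| <= M) ->
  (forall a : nat -> E, (forall n, A (a n)) ->
    exists p, forall Q n, weak_nbhd D p Q -> exists2 m, (n <= m)%N & Q (a m)) ->
  rel_weak_compact setT (@Num.norm R E) A.
Proof.
move=> AM Aclust; apply: rel_weak_compact_filters => // F FF FA.
have [G [UG FG]] := ultraFilterLemma FF.
have GA : G A by exact: FG.
pose ev (x : E) (f : E -> R) := f x.
have evl x : lin_on D (ev x : (E -> R) -> R^o) by apply/linfunP.
have evb f : D f -> exists K, G [set x | `|ev x f| <= K].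
  move=> [_ [C fC]]; exists (`|C| * M); apply: filterS GA => x /AM xM.
  rewrite /= (le_trans (fC x I))// (@le_trans _ _ (`|C| * `|x|))//.
    by rewrite ler_wpM2r// ler_norm.
  exact: ler_wpM2l.
pose X := ultra_lim G ev.
have Xl : lin_on D (X : (E -> R) -> R^o) by exact: ultra_lim_lin.
have XG f : D f -> f @ G --> X f by exact: (ultra_lim_cvg UG evb).
suff [p pX] : exists e, forall f, D f -> X f = f e.
  exists p; split=> // U Q FU [n [fs [eps [Dfs eps0 Qeps]]]].
  have : G [set x | forall i, (i < n)%N -> `|fs i x - fs i p| < eps].
    apply: (@filter_forall_lt _ _ _ n (fun i => [set x | `|fs i x - fs i p| < eps])) => i ilt.
    have /XG := Dfs i ilt; rewrite (pX _ (Dfs i ilt)) => /cvgrPdist_lt/(_ _ eps0).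
    by apply: filterS => x /=; rewrite distrC.
  move=> /(filterI (FG _ FU)) /filter_ex[x [Ux xp]].
  by exists x; split=> //; exact: Qeps.
apply: bidual_closed => // d d0; apply: contrapT => /forallNP nonear.
have {}nonear e : exists2 f, contractive f & d < `|X f - f e|.
  have /existsNP[f /not_implyP[fc /negP]] := nonear e.
  by rewrite -ltNge; exists f.
have Helly s := helly s (ltW d0) Xl nonear.
(* a state holds the points chosen so far, the [G]-large set on which the functionals chosen so far
   exceed [d / 2], and the last functional and point chosen *)
pose inv (t : (seq E * set E) * ((E -> R) * E)) := [/\ G t.1.2, contractive t.2.1 & A t.2.2].
pose next (t t' : {t | inv t}) := let: (s, U, (f, a)) := sval t' in
  [/\ s = a :: (sval t).1.1, U `<=` (sval t).1.2, U `<=` [set x | d / 2 < f x],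
    (sval t).1.2 a /\ d / 2 < f a & forall b, b \in (sval t).1.1 -> f b = 0].
have step t : {t' | next t t'}.
  apply: cid; case: t => -[[s U] [f0 a0]] tinv; have [/= GU _ _] := tinv.
  have [f [fc fs Xf]] := Helly s.
  have Gf : G [set x | d / 2 < f x].
    have /cvgrPdist_lt/(_ (d / 2)) : f @ G --> X f by apply: XG; case: fc.
    rewrite divr_gt0// => /(_ isT); apply: filterS => x /=.
    by rewrite ltr_norml => /andP[_]; lra.
  have GUf : G (U `&` [set x | d / 2 < f x]) by exact: filterI.
  have [a [Aa [Ua fa]]] := filter_ex (filterI GA GUf).
  have invt : inv (a :: s, U `&` [set x | d / 2 < f x], (f, a)) by [].
  by exists (exist _ _ invt); split=> //= x [].
have [a0 Aa0] := filter_ex GA.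
have inv0 : inv ([:: a0], setT, (0, a0)).
  split=> //=; first exact: filterT.
  split=> [|x]; first exact: subspace0 (@Edual_subspace R E).
  by rewrite normr0.
have [t [_ tS]] := dependent_choice step (exist _ _ inv0).
pose f_ n := (sval (t n.+1)).2.1; pose a_ n := (sval (t n.+1)).2.2.
have fc n : contractive (f_ n) by have [] := svalP (t n.+1).
have Aa n : A (a_ n) by have [] := svalP (t n.+1).
have tS' n : [/\ (sval (t n.+1)).1.1 = a_ n :: (sval (t n)).1.1,
    (sval (t n.+1)).1.2 `<=` (sval (t n)).1.2,
    (sval (t n.+1)).1.2 `<=` [set x | d / 2 < f_ n x],
    (sval (t n)).1.2 (a_ n) /\ d / 2 < f_ n (a_ n) &
    forall b, b \in (sval (t n)).1.1 -> f_ n b = 0].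
  by have := tS n; rewrite /next /f_ /a_; case: (sval (t n.+1)) => -[s U] [f a].
have fa_big n m : (n <= m)%N -> d / 2 < f_ n (a_ m).
  rewrite leq_eqVlt => /predU1P[<-|nm]; first by have [_ _ _ []] := tS' n.
  have [_ _ sub _ _] := tS' n; apply: sub.
  have [_ _ _ [+ _] _] := tS' m.
  elim: m nm {Aa} (a_ m) => // m IHm; rewrite ltnS leq_eqVlt => /predU1P[<-//|nm] x.
  by have [_ sub _ _ _] := tS' m => /sub; exact: IHm.
have fa_0 n m : (m < n)%N -> f_ n (a_ m) = 0.
  move=> mn; have [_ _ _ _] := tS' n; apply.
  elim: n mn => // n IHn; have [-> _ _ _ _] := tS' n.
  by rewrite ltnS leq_eqVlt inE => /predU1P[->|/IHn->]; rewrite ?eqxx ?orbT.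
have [p pclust] := Aclust _ Aa.
have fp n : d / 2 <= f_ n p.
  apply/ler_addgt0Pr => eps eps0.
  have [|m nm] := pclust [set x | `|f_ n x - f_ n p| < eps] n.
    exists 1%N, (fun=> f_ n), eps; split=> // [_ _|x xp]; first by case: (fc n).
    exact: (xp 0%N).
  by rewrite /= ltr_norml => /andP[_]; have := fa_big _ _ nm; lra.
have [V [UV oV]] := ultraFilterLemma (@eventually_filter).
have fl n : lin_on setT (f_ n : E -> R^o) by have [[]] := fc n.
have fb (v : E) : [set: E] v -> exists K, V [set n | `|f_ n v| <= K].
  by move=> _; exists `|v|; apply: filterS filterT => n _; have [_] := fc n; apply.
pose f := ultra_lim V f_.
have Df : D f.
  split; first exact: ultra_lim_lin.
  exists 1 => x _; rewrite mul1r; apply: (ultra_lim_le UV fb) => //.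
  by apply: filterS filterT => n _; have [_] := fc n; apply.
have f0 m : f (a_ m) = 0.
  apply: cvg_lim => //; apply: cvg_near_cst; apply: oV; exists m.+1 => // n /= mn.
  by rewrite fa_0.
have fpd : d / 2 <= f p.
  apply: (cvgr_to_ge (ultra_lim_cvg UV fb (I : [set: E] p))).
  by apply: filterS filterT.
have [|m _] := pclust [set x | `|f x - f p| < d / 2] 0%N.
  exists 1%N, (fun=> f), (d / 2); split=> //; first by rewrite divr_gt0.
  by move=> x xp; exact: (xp 0%N).
by rewrite /= f0 sub0r normrN => /(le_lt_trans (ler_norm _)); lra.
Qed.

End EberleinSmulian.

(** * The dual of c_0 *)

Section C0.
Context (R : realType).
Local Notation seqR := (nat -> R).
Local Notation D0 := (dual_on (@c0 R) (@c0norm R)).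

Lemma c0_bounded (u : seqR) : c0 u -> bounded_seq u.
Proof.
move=> cu; have /cvgrPdist_le/(_ _ ltr01)[n _ un] := cu.
exists (\sum_(k < n) `|u k| + 1) => k; have [kn|nk] := ltnP k n.
  rewrite (bigD1 (Ordinal kn))//= -addrA lerDl; apply: addr_ge0 => //.
  by apply: sumr_ge0 => i _; exact: normr_ge0.
have := un k nk; rewrite /= sub0r normrN => /le_trans; apply.
by rewrite lerDr; apply: sumr_ge0 => i _; exact: normr_ge0.
Qed.

Lemma c0_subspace : is_subspace (@c0 R).
Proof.
split; first exact: cvg_cst.
move=> a u v cu cv; rewrite /c0 /=.
have -> : (0 : R) = a * 0 + 0 by rewrite mulr0 addr0.
by apply: cvgD => //; exact: cvgMl_tmp.
Qed.

Lemma c0norm_le (u : seqR) M : (forall k, `|u k| <= M) -> c0norm u <= M.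
Proof.
move=> uM; apply: ge_sup; first by exists `|u 0%N|, 0%N.
by move=> _ [n _ <-].
Qed.

Lemma le_c0norm (u : seqR) k : c0 u -> `|u k| <= c0norm u.
Proof.
move=> /c0_bounded[M uM]; apply: ub_le_sup; last by exists k.
by exists M => _ [n _ <-].
Qed.

Lemma c0_coord k : D0 (fun u : seqR => u k).
Proof. by split=> //; exists 1 => u cu; rewrite mul1r; exact: le_c0norm. Qed.

Lemma c0_finite (u : seqR) n : (forall k, (n <= k)%N -> u k = 0) -> c0 u.
Proof.
move=> un; apply: cvg_near_cst.
by exists n => // k /= /un ->.
Qed.

(* On bounded subsets of c_0 the weak topology is that of coordinatewise convergence. *)
Lemma c0_functional_small phi M eps : D0 phi -> 0 < M -> 0 < eps ->
  exists n delta, 0 < delta /\ forall w : seqR, c0 w -> (forall k, `|w k| <= M) ->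
    (forall k, (k < n)%N -> `|w k| < delta) -> `|phi w| < eps.
Proof.
move=> [phil [C' phiC']] M0 eps0.
pose C := Num.max C' 1.
have C0 : 0 < C by rewrite lt_max ltr01 orbT.
have phiC u K : c0 u -> (forall k, `|u k| <= K) -> `|phi u| <= C * K.
  move=> cu uK; rewrite (le_trans (phiC' _ cu))//.
  have n0 : 0 <= c0norm u by rewrite (le_trans (normr_ge0 _) (le_c0norm 0%N cu)).
  rewrite (@le_trans _ _ (C * c0norm u))// ?ler_wpM2r// ?le_max ?lexx//.
  by rewrite ler_wpM2l ?c0norm_le// ltW.
(* The sequence in l_1 that represents [phi]; evaluating [phi] on truncated signs of [c] bounds the
   partial sums of |c k| by [C]. *)
pose c k := phi (l1_unit R k).
pose cut n (w : seqR) : seqR := fun k => if (k < n)%N then w k else 0.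
have c0cut n w : c0 (cut n w) by apply: (@c0_finite _ n) => k; rewrite /cut ltnNge => ->.
have phicut n w : phi (cut n w) = \sum_(k < n) w k * c k.
  have cu i : c0 (l1_unit R i).
    by apply: (@c0_finite _ i.+1) => k ik; rewrite /l1_unit gtn_eqF.
  have -> : cut n w = \sum_(k < n) w k *: l1_unit R k.
    apply/funext => i; rewrite fct_sumE /cut; case: ltnP => ni.
      rewrite (bigD1 (Ordinal ni))//= big1 => [|k kn].
        by rewrite addr0 fct_scaleE /l1_unit eqxx mulr1.
      by rewrite fct_scaleE /l1_unit; move: kn; rewrite -val_eqE eq_sym/= => /negbTE ->; rewrite mulr0.
    by rewrite big1// => k _; rewrite fct_scaleE /l1_unit gtn_eqF ?mulr0// (leq_trans _ ni).
  rewrite (lin_on_sum c0_subspace phil (u := fun k => w k *: l1_unit R k)).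
    by apply: eq_bigr => k _; rewrite (linfunZ c0_subspace _ phil).
  by move=> i _; exact: (subspaceZ c0_subspace).
have sumc n : \sum_(k < n) `|c k| <= C.
  have -> : \sum_(k < n) `|c k| = phi (cut n (fun k => Num.sg (c k))).
    by rewrite phicut; apply: eq_bigr => k _; rewrite -normrEsg.
  rewrite (le_trans (ler_norm _))// -[leRHS]mulr1 phiC// => k.
  by rewrite /cut; case: ltnP => _; rewrite ?normr0// normr_sg lern1 leq_b1.
have lc : l1 c by exact: l1_bounded sumc.
have phi_cut_cvg w : c0 w -> (fun n => phi (cut n w)) @ \oo --> phi w.
  move=> cw; apply/cvgrPdist_le => e e0.
  have eC : 0 < e / C by rewrite divr_gt0.
  have /cvgrPdist_le/(_ _ eC)[n _ wn] := cw.
  exists n => // m /= nm; rewrite -[phi w - _](lin_onB c0_subspace phil)//.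
  have -> : e = C * (e / C) by field; exact: lt0r_neq0.
  apply: phiC; first exact: (subspaceB c0_subspace).
  move=> k; rewrite fct_subE /cut; case: ltnP => mk; first by rewrite subrr normr0 ltW.
  by rewrite subr0; have := wn k (leq_trans nm mk); rewrite /= sub0r normrN.
have tail : exists n, forall m, \sum_(k < m) `|c k| <= \sum_(k < n) `|c k| + eps / 4 / M.
  have e4 : 0 < eps / 4 / M by rewrite !divr_gt0.
  have /cvgrPdist_le/(_ _ e4)[n _ nP] : series (fun k => `|c k|) @ \oo --> l1norm c by exact: lc.
  exists n => m; rewrite (le_trans (l1_sum_le m lc))//.
  have : `|l1norm c - series (fun k => `|c k|) n| <= eps / 4 / M by exact: (nP n (leqnn n)).
  rewrite seriesEord /= ler_norml => /andP[_].
  by rewrite lerBlDl.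
have [n tailn] := tail.
(* The first [n] coordinates contribute at most delta * C = eps / 4, the others at most M times a
   tail of size eps / 4 / M. The total eps / 2 leaves room for a strict inequality after the limit
   over truncations. *)
exists n, (eps / 4 / C); split; first by rewrite !divr_gt0.
move=> w cw wM wd; apply: (@le_lt_trans _ _ (eps / 2)); last by lra.
apply: (cvgr_to_le (cvg_norm (phi_cut_cvg _ cw))).
exists n => // m /= nm; rewrite phicut.
rewrite -(big_mkord xpredT (fun k => w k * c k)) (big_cat_nat (leq0n n) nm)//= !big_mkord.
rewrite (le_trans (ler_normD _ _))//.
have -> : eps / 2 = eps / 4 + eps / 4 by lra.
apply: lerD.
  rewrite (le_trans (ler_norm_sum _ _ _))//.
  rewrite (@le_trans _ _ (\sum_(k < n) (eps / 4 / C) * `|c k|))//.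
    by apply: ler_sum => k _; rewrite normrM ler_wpM2r// ltW// wd.
  by rewrite -mulr_sumr -ler_pdivlMl ?divr_gt0// (le_trans (sumc n))// invf_div divfK// gt_eqF// divr_gt0.
rewrite (le_trans (ler_norm_sum _ _ _))//.
rewrite (@le_trans _ _ (\sum_(n <= k < m) M * `|c k|))//.
  by apply: ler_sum => k _; rewrite normrM ler_wpM2r.
rewrite -mulr_sumr -ler_pdivlMl// mulrC.
have := tailn m.
rewrite -(big_mkord xpredT (fun k => `|c k|)) (big_cat_nat (leq0n n) nm)//= !big_mkord.
by rewrite lerD2l.
Qed.

End C0.

(** * Almost Grothendieck operators *)

Lemma rel_weak_compact_cluster (R : realType) (V : lmodType R) (P : set V) (N : V -> R)
    (B : set V) (b : nat -> V) :
  rel_weak_compact P N B -> B `<=` P -> (forall n, B (b n)) ->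
  exists p, P p /\ forall Q n, weak_nbhd (dual_on P N) p Q -> exists2 m, (n <= m)%N & Q (b m).
Proof.
move=> KB BP Bb.
have [|p [[Pp _] pclust]] := KB (b @ \oo) _ _.
  apply: (@filterS _ \oo _ setT) => [n _|]; last exact: filterT.
  split=> [|Q [n' [fs [e [_ e0 Qe]]]]]; first exact: BP.
  by exists (b n); split=> //; apply: Qe => i _; rewrite subrr normr0.
exists p; split=> // Q n pQ.
have [|_ [[m nm <-] Qm]] := pclust [set b m | m in [set m | (n <= m)%N]] Q _ pQ.
  by exists n => // m nm; exists m.
by exists m.
Qed.

Lemma uniform_boundedness (R : realType) (E : completeNormedModType R) (J : Type)
    (f : J -> E -> R) :
  (forall i, Edual (f i)) -> (forall x, exists M, forall i, `|f i x| <= M) ->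
  exists2 K, 0 < K & forall i x, `|f i x| <= K * `|x|.
Proof.
move=> Df fM.
have [||M MP] := @Banach_Steinhauss R E R^o (range (f : J -> E -> R^o)) _ _ 1.
- move=> _ [i _ <-]; have [fl [C fC]] := Df i; split.
    move=> r; exists (`|C| * r) => x xr; rewrite (le_trans (fC x I))//.
    by rewrite (le_trans (ler_wpM2r _ (ler_norm C)))// ler_wpM2l.
  by move=> a u v; exact: fl.
- by move=> x; have [M MP] := fM x; exists M => _ [i _ <-]; exact: MP.
exists (Num.max M 1); first by rewrite lt_max ltr01 orbT.
move=> i x; have [fl _] := Df i.
have [->|x0] := eqVneq x 0; first by rewrite (lin_on0 (subspaceT E) fl) !normr0 mulr0.
have : `|f i (`|x|^-1 *: x)| <= M.
  by apply: (MP (f i)); [exists i|rewrite normrZ normfV normr_id mulVf ?normr_eq0].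
rewrite (linfunZ (subspaceT E) _ fl)// normrM normfV normr_id ler_pdivrMl ?normr_gt0//.
by rewrite mulrC => /le_trans; apply; rewrite ler_wpM2r// le_max lexx.
Qed.

(** * Absolutely convergent series with coefficients in l_1 *)

Section L1Sum.
Context (R : realType) (W : completeNormedModType R).
Implicit Types (u : nat -> R) (x : nat -> W).

(** For W = E this is the operator on l_1 that maps the unit vectors to the [x k]; for W = R it is
    the pairing of l_1 with l_infty. *)
Definition l1_sum u x : W := limn (series (fun k => u k *: x k)).

Lemma l1_sum_cvg u x M : l1 u -> (forall k, `|x k| <= M) ->
  series (fun k => u k *: x k) @ \oo --> l1_sum u x.
Proof.
move=> lu xM; apply: normed_cvg; apply: nondecreasing_is_cvgn.
  by apply: nondecreasing_series => n _ _ /=.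
have M0 : 0 <= M by exact: le_trans (xM 0%N).
exists (l1norm u * M) => _ [n _ <-]; rewrite /normed_series_of seriesEord /=.
apply: le_trans (ler_wpM2r M0 (l1_sum_le n lu)).
by rewrite mulr_suml ler_sum// => k _; rewrite normrZ ler_wpM2l.
Qed.

Lemma l1_sum_lin x M : (forall k, `|x k| <= M) -> lin_on (@l1 R) (l1_sum^~ x).
Proof.
move=> xM a u v lu lv; apply: cvg_lim => //.
have -> : series (fun k => (a *: u + v) k *: x k) =
    (fun n => a *: series (fun k => u k *: x k) n + series (fun k => v k *: x k) n).
  apply/funext => n; rewrite !seriesEord /= scaler_sumr -big_split/=.
  by apply: eq_bigr => k _; rewrite fct_combE scalerDl scalerA.
by apply: cvgD; [apply: cvgZr; exact: l1_sum_cvg xM|exact: l1_sum_cvg xM].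
Qed.

Lemma l1_sum_linr u x y a M N : l1 u -> (forall k, `|x k| <= M) -> (forall k, `|y k| <= N) ->
  l1_sum u (fun k => a *: x k + y k) = a *: l1_sum u x + l1_sum u y.
Proof.
move=> lu xM yN; apply: cvg_lim => //.
have -> : series (fun k => u k *: (a *: x k + y k)) =
    (fun n => a *: series (fun k => u k *: x k) n + series (fun k => u k *: y k) n).
  apply/funext => n; rewrite !seriesEord /= scaler_sumr -big_split/=.
  by apply: eq_bigr => k _; rewrite scalerDr !scalerA mulrC.
by apply: cvgD; [apply: cvgZr; exact: l1_sum_cvg xM|exact: l1_sum_cvg yN].
Qed.

Lemma l1_sum_norm_le u x M : l1 u -> (forall k, `|x k| <= M) -> `|l1_sum u x| <= M * l1norm u.
Proof.
move=> lu xM; have M0 : 0 <= M by exact: le_trans (xM 0%N).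
apply: (cvgr_to_le (cvg_norm (l1_sum_cvg lu xM))); apply: nearW => n.
rewrite seriesEord /= (le_trans (ler_norm_sum _ _ _))//.
rewrite (@le_trans _ _ (M * \sum_(k < n) `|u k|))//; last by rewrite ler_wpM2l// l1_sum_le.
by rewrite mulr_sumr ler_sum// => k _; rewrite normrZ mulrC ler_wpM2r.
Qed.

Lemma l1_sum_unit n x : l1_sum (l1_unit R n) x = x n.
Proof.
apply: cvg_lim => //; apply: cvg_near_cst; exists n.+1 => // m /= nm.
rewrite seriesEord /= (bigD1 (Ordinal nm))//= big1 => [|k kn].
  by rewrite addr0 /l1_unit eqxx scale1r.
by move: kn; rewrite -val_eqE/= /l1_unit => /negbTE ->; rewrite scale0r.
Qed.

Lemma Edual_l1_sum (f : W -> R) u x M : Edual f -> l1 u -> (forall k, `|x k| <= M) ->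
  series (fun k => u k * f (x k)) @ \oo --> f (l1_sum u x).
Proof.
move=> [fl [C fC]] lu xM.
have -> : series (fun k => u k * f (x k)) = (fun n => f (series (fun k => u k *: x k) n)).
  apply/funext => n; rewrite !seriesEord /=.
  rewrite (lin_on_sum (subspaceT W) fl (u := fun k => u k *: x k))//.
  by apply: eq_bigr => k _; rewrite (linfunZ (subspaceT W) _ fl).
have C'0 : 0 < `|C| + 1 by rewrite ltr_wpDl.
apply/cvgrPdist_lt => e e0; have eC : 0 < e / (`|C| + 1) by rewrite divr_gt0.
have /cvgrPdist_lt/(_ _ eC) := l1_sum_cvg lu xM.
apply: filterS => n; rewrite ltr_pdivlMr// mulrC; apply: le_lt_trans.
rewrite -[f _ - f _](lin_onB (subspaceT W) fl)// (le_trans (fC _ I))// ler_wpM2r//.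
by rewrite (le_trans (ler_norm C))// lerDl.
Qed.

End L1Sum.

(* A weak cluster point in c_0 is read off an ultrafilter limit, viewed as an element of the bidual
   of [X]. *)
Lemma almost_grothendieck_image (R : realType) (E : completeNormedModType R) (j : E -> E -> E)
    (X : completeNormedModType R) (T : X -> E) :
  bounded_op setT (@Num.norm R X) T ->
  almost_grothendieck_op j setT (@Num.norm R X) T ->
  almost_grothendieck_set j [set T u | u in [set u | [set: X] u /\ `|u| <= 1]].
Proof.
move=> [Tl [C TC]] AGT y ynull ydisj.
have [Dy y0] := ynull.
have [K K0 yK] : exists2 K, 0 < K & forall n x, `|y n x| <= K * `|x|.
  apply: uniform_boundedness => // x; exact: c0_bounded (y0 x).
set B := [set _ | _ in _].
pose M := K * (`|C| + 1).
have M0 : 0 < M by rewrite mulr_gt0// ltr_wpDl.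
have BM b : B b -> forall n, `|b n| <= M.
  move=> [_ [u [_ u1] <-] <-] n; rewrite (le_trans (yK _ _))// ler_pM2l//.
  rewrite (le_trans (TC u I))// (@le_trans _ _ (`|C| * `|u|))//.
    by rewrite ler_wpM2r// ler_norm.
  by rewrite (@le_trans _ _ `|C|)// ?lerDl// ler_piMr.
have Bc0 : B `<=` @c0 R by move=> _ [x _ <-]; exact: y0.
apply: rel_weak_compact_filters => // F FF FB.
have [G [UG FG]] := ultraFilterLemma FF.
have GB : G B by exact: FG.
(* A chosen preimage of [b] in the unit ball of [X]: evaluations at the [s b] converge along [G] to
   an element of the bidual of [X]. *)
pose s (b : nat -> R) := get [set u : X | `|u| <= 1 /\ b = (fun n => y n (T u))].
have sP b : B b -> `|s b| <= 1 /\ b = (fun n => y n (T (s b))).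
  move=> [_ [u [_ u1] <-] <-].
  by apply: (getPex (P := [set v : X | `|v| <= 1 /\ (fun n => y n (T u)) = (fun n => y n (T v))])); exists u.
pose phi (b : nat -> R) (f : X -> R) := f (s b).
have subD := @Edual_subspace R X.
have nX (u : X) : [set: X] u -> 0 <= `|u| by [].
have phil b : lin_on (@Edual R X) (phi b : (X -> R) -> R^o) by apply/linfunP.
have phi_le f : Edual f -> G [set b | `|phi b f| <= dual_norm setT (@Num.norm R X) f].
  by move=> Df; apply: filterS GB => b /sP[sb _] /=; apply: (dual_norm_ge nX).
have phib f : Edual f -> exists L, G [set b | `|phi b f| <= L].
  by move=> /phi_le; exists (dual_norm setT (@Num.norm R X) f).
have DyT n : Edual (fun u => y n (T u)).
  have [yl _] := Dy n; split.
    by apply/linfunP => a u v _ _; rewrite Tl// ((linfunP _ _).1 yl).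
  exists (K * C) => u _; rewrite (le_trans (yK _ _))// -mulrA ler_pM2l//; exact: TC.
pose p n := ultra_lim G phi (fun u => y n (T u)).
(* [p n] is the value of that bidual element at the adjoint image of [y n], so the hypothesis on [T]
   says exactly that it tends to 0. *)
have cp : c0 p.
  apply: AGT => //; split; first exact: ultra_lim_lin.
  by exists 1 => f Df; rewrite mul1r; apply: (ultra_lim_le UG phib) => //; exact: phi_le.
have pG k : (fun b : nat -> R => b k) @ G --> p k.
  have := ultra_lim_cvg UG phib (DyT k); apply: cvg_trans.
  by apply: near_eq_cvg; apply: filterS GB => b /sP[_ bE]; rewrite [in RHS]bE.
have pM k : `|p k| <= M.
  by apply: (cvgr_to_le (cvg_norm (pG k))); apply: filterS GB => b /BM.
exists p; split=> // U Q FU [n [fs [eps [Dfs eps0 Qeps]]]].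
have : G [set b | forall i, (i < n)%N -> `|fs i b - fs i p| < eps].
  apply: (@filter_forall_lt _ _ _ n (fun i => [set b | `|fs i b - fs i p| < eps])) => i ilt.
  have M20 : 0 < M + M by rewrite addr_gt0.
  have [m [d [d0 small]]] := c0_functional_small (Dfs i ilt) M20 eps0.
  have : G [set b : nat -> R | forall k, (k < m)%N -> `|b k - p k| < d].
    apply: (@filter_forall_lt _ _ _ m (fun k => [set b : nat -> R | `|b k - p k| < d])) => k _.
    have /cvgrPdist_lt/(_ _ d0) := pG k.
    by apply: filterS => b /=; rewrite distrC.
  apply: filterS2 GB => b Bb bp /=; have [fl _] := Dfs i ilt.
  rewrite -[fs i b - _](lin_onB (@c0_subspace R) fl) ?Bc0//; last exact: Bc0.
  apply: small => //; first by apply: (subspaceB (@c0_subspace R)) => //; exact: Bc0.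
  by move=> k; rewrite (le_trans (ler_normB _ _))// lerD// BM.
move=> /(filterI (FG _ FU)) /filter_ex[b [Ub bp]].
by exists b; split=> //; exact: Qeps.
Qed.

(** * Banach lattices and almost Grothendieck sets *)

Section BanachLattice.
Context (R : realType) (E : completeNormedModType R) (j : E -> E -> E).
Hypothesis blE : is_banach_lattice j.
Local Notation "x <=L y" := (lat_le j x y) (at level 70).
Local Notation D := (@Edual R E).

Let jC x y : j x y = j y x. Proof. by case: blE. Qed.
Let jA x y z : j x (j y z) = j (j x y) z. Proof. by case: blE => _ []. Qed.
Let jxx x : j x x = x. Proof. by case: blE => _ []. Qed.
Let leD x y z : x <=L y -> x + z <=L y + z. Proof. by case: blE => _ _ + _ _; apply. Qed.
Let leZ (a : R) x y : 0 <= a -> x <=L y -> a *: x <=L a *: y.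
Proof. by case: blE => _ _ _ + _; apply. Qed.
Let le_abs_norm x y : lat_abs j x <=L lat_abs j y -> `|x| <= `|y|.
Proof. by case: blE => _ _ _ _; apply. Qed.

Lemma lat_le_trans y x z : x <=L y -> y <=L z -> x <=L z.
Proof. by rewrite /lat_le => xy yz; rewrite -yz jA xy. Qed.

Lemma lat_le_anti x y : x <=L y -> y <=L x -> x = y.
Proof. by rewrite /lat_le => xy yx; rewrite -{1}yx jC. Qed.

Lemma lat_le_joinl x y : x <=L j x y.
Proof. by rewrite /lat_le jA jxx. Qed.

Lemma lat_le_joinr x y : y <=L j x y.
Proof. by rewrite jC; exact: lat_le_joinl. Qed.

Lemma join_lat_le x y z : x <=L z -> y <=L z -> j x y <=L z.
Proof. by rewrite /lat_le => xz yz; rewrite -jA yz. Qed.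

Lemma lat_leD x y z t : x <=L y -> z <=L t -> x + z <=L y + t.
Proof.
move=> xy zt; apply: (lat_le_trans (leD z xy)).
by rewrite ![y + _]addrC; exact: leD.
Qed.

Lemma lat_oppr_le0 x : 0 <=L x -> - x <=L 0.
Proof. by move=> /(leD (- x)); rewrite add0r subrr. Qed.

Lemma lat_abs_ge0 x : 0 <=L lat_abs j x.
Proof.
have := lat_leD (lat_le_joinl x (- x)) (lat_le_joinr x (- x)).
rewrite subrr => /(@leZ 2^-1); rewrite invr_ge0 ler0n => /(_ isT).
have h2 : 2^-1 + 2^-1 = 1 :> R by field.
by rewrite scaler0 scalerDr -scalerDl h2 scale1r.
Qed.

Lemma lat_abs_nonneg x : 0 <=L x -> lat_abs j x = x.
Proof. by move=> x0; rewrite /lat_abs jC; apply: (lat_le_trans (lat_oppr_le0 x0)). Qed.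

Definition pos_part x := j x 0.

Lemma pos_part_ge0 x : 0 <=L pos_part x. Proof. exact: lat_le_joinr. Qed.

Lemma lat_norm_le x y : 0 <=L x -> x <=L y -> `|x| <= `|y|.
Proof.
move=> x0 xy; apply: le_abs_norm.
by rewrite !lat_abs_nonneg//; exact: lat_le_trans xy.
Qed.

Lemma pos_partD x y : `|pos_part (x + y)| <= `|pos_part x| + `|pos_part y|.
Proof.
apply: le_trans (ler_normD _ _); apply: lat_norm_le; first exact: pos_part_ge0.
apply: join_lat_le; first by apply: lat_leD; exact: lat_le_joinl.
by rewrite -[0]addr0; apply: lat_leD; exact: pos_part_ge0.
Qed.

Lemma pos_partZ (a : R) x : 0 < a -> pos_part (a *: x) = a *: pos_part x.
Proof.
have le (b : R) y : 0 < b -> pos_part (b *: y) <=L b *: pos_part y.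
  move=> /ltW b0; apply: join_lat_le; first by apply: leZ => //; exact: lat_le_joinl.
  by rewrite -[0](scaler0 _ b); apply: leZ => //; exact: pos_part_ge0.
move=> a0; apply: lat_le_anti; first exact: le.
have := le a^-1 (a *: x); rewrite invr_gt0 => /(_ a0) /(leZ (ltW a0)).
by rewrite !scalerA mulVf ?mulfV ?gt_eqF// !scale1r.
Qed.

Lemma norm_pos_part_le x : `|pos_part x| <= `|x|.
Proof.
apply: le_abs_norm; rewrite (lat_abs_nonneg (pos_part_ge0 x)).
by apply: join_lat_le; [exact: lat_le_joinl|exact: lat_abs_ge0].
Qed.

Lemma norm_le_pos_parts x : `|x| <= `|pos_part x| + `|pos_part (- x)|.
Proof.
suff {1}-> : x = pos_part x - pos_part (- x) by exact: ler_normB.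
suff -> : pos_part (- x) = pos_part x - x by rewrite opprB addrC subrK.
apply: lat_le_anti.
  apply: join_lat_le; last first.
    by have := leD (- x) (lat_le_joinl x 0); rewrite subrr.
  by have := leD (- x) (pos_part_ge0 x); rewrite add0r.
suff /(leD (- x)) : pos_part x <=L pos_part (- x) + x by rewrite addrK.
apply: join_lat_le; first by have := leD x (pos_part_ge0 (- x)); rewrite add0r.
by have := leD x (lat_le_joinl (- x) 0); rewrite addNr.
Qed.

Definition positive_functional (f : E -> R) := forall x, 0 <=L x -> 0 <= f x.

(** Hahn-Banach is applied under the sublinear map that sends u to the norm of its positive part; as
    the positive part of -u is 0 for u >= 0, a dominated functional is positive. One of the positive
    parts of x and -x carries at least half of the norm of x, hence the factor 2. *)
Lemma positive_norming (x : E) :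
  exists f, [/\ contractive f, positive_functional f & `|x| <= 2 * `|f x|].
Proof.
have key y : exists f, [/\ contractive f, positive_functional f & f y = `|pos_part y|].
  have [|a u a0|f [fl fy fp]] := @hahn_banach_point R E (fun u => `|pos_part u|) _ _ y.
  - exact: pos_partD.
  - by rewrite pos_partZ// normrZ gtr0_norm.
  have fc u : `|f u| <= `|u|.
    rewrite ler_norml (le_trans (fp _) (norm_pos_part_le u)) andbT lerNl.
    rewrite -[- f u](lin_onN (subspaceT E) fl)// -[leRHS]normrN.
    exact: le_trans (fp _) (norm_pos_part_le _).
  exists f; split=> //; first by split=> //; split=> //; exists 1 => u _; rewrite mul1r.
  move=> u /lat_oppr_le0 u0; have := fp (- u).
  by rewrite /pos_part u0 normr0 (lin_onN (subspaceT E) fl)// oppr_le0.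
have [f [fc fpos fx]] := key x; have [g [gc gpos gx]] := key (- x).
have [[[fl _] _] [[gl _] _]] := (fc, gc).
have := norm_le_pos_parts x; rewrite -fx -gx (lin_onN (subspaceT E) gl)// => xfg.
have := ler_norm (f x); have := ler_norm (- g x); rewrite normrN => g1 f1.
have [gf|/ltW fg] := leP `|g x| `|f x|; [exists f|exists g]; split=> //; lra.
Qed.

(** * Norm boundedness of almost Grothendieck sets *)

Section AlmostGrothendieckSet.
Variable A : set E.
Hypothesis AG : almost_grothendieck_set j A.

Lemma almost_grothendieck_cluster (y : nat -> E -> R) (a : nat -> E) :
  weak_star_null y -> disjoint_seq j y -> (forall m, A (a m)) ->
  exists p, c0 p /\ forall n e N, 0 < e -> exists2 m, (N <= m)%N & `|y n (a m) - p n| < e.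
Proof.
move=> ynull ydisj Aa.
have [u|m|p [cp pclust]] := rel_weak_compact_cluster (b := fun m n => y n (a m)) (AG ynull ydisj).
- by move=> [x _ <-]; case: ynull => _; apply.
- by exists (a m).
exists p; split=> // n e N e0.
have [|m Nm am] := pclust [set u | `|u n - p n| < e] N; last by exists m.
exists 1%N, (fun _ u => u n), e; split=> // [_ _|u up]; first exact: c0_coord.
exact: (up 0%N).
Qed.

(** A positive [f] is its own modulus, so the disjointness of [f] and 0 can be checked directly,
    with no lattice operation to construct in the dual. *)
Lemma almost_grothendieck_positive_bounded (f : E -> R) :
  Edual f -> positive_functional f -> exists M, forall x, A x -> `|f x| <= M.
Proof.
move=> Df fpos; apply: contrapT => /forallNP unb.
have [a aP] : {a : nat -> E & forall n, A (a n) /\ n%:R < `|f (a n)|}.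
  apply: (choice (P := fun n x => A x /\ n%:R < `|f x|)) => n.
  have /existsNP[x /not_implyP[Ax /negP]] := unb n%:R.
  by rewrite -ltNge; exists x.
pose zero : E -> R := fun=> 0.
have Dzero : D zero by exact: (subspace0 (@Edual_subspace R E)).
pose y n := if n == 0%N then f else zero.
have Dopp : D (fun x => - f x) by exact: (subspaceN (@Edual_subspace R E) Df).
have ynull : weak_star_null y.
  split=> [n|x]; first by rewrite /y; case: ifP.
  by apply: cvg_near_cst; exists 1%N => // n; rewrite /y /= lt0n => /negbTE ->.
have supf : dual_is_sup j f (fun x => - f x) f.
  by split=> // x x0; have := fpos x x0; lra.
have sup0 : dual_is_sup j zero (fun x => - zero x) zero.
  by split=> // x x0; rewrite oppr0.
have ydisj : disjoint_seq j y.
  move=> n m nm; rewrite /y; case: eqP => n0; case: eqP => m0.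
  - by case: nm; rewrite n0 m0.
  - by exists f, zero; split=> //; split.
  - by exists zero, f; split=> //; split.
  - by exists zero, zero; split=> //; split.
have [p [_ pP]] := almost_grothendieck_cluster ynull ydisj (fun n => (aP n).1).
(* Beyond this index |f (a m)| > 1 + |p 0|, so [f (a m)] cannot come within 1 of [p 0]. *)
have [m mN] := pP 0%N 1 (Num.truncn (1 + `|p 0%N|)).+1 ltr01.
apply/negP; rewrite -leNgt /y /=.
have pm : 1 + `|p 0%N| < `|f (a m)|.
  rewrite (lt_trans (truncnS_gt _))// (le_lt_trans _ (aP m).2)// ler_nat//.
by have := lerB_normD (f (a m)) (- p 0%N); rewrite normrN; lra.
Qed.

(** For nonnegative u in l_1 the sum of the u_k g_k is positive, hence bounded on [A]; splitting u
    into positive and negative parts makes the maps u -> f u (a n) pointwise bounded on l_1, hence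
    uniformly bounded. At the unit vectors this bounds g_n (a_n), and with it the norm of a_n. *)
Lemma almost_grothendieck_bounded : exists M, forall x, A x -> `|x| <= M.
Proof.
apply: contrapT => /forallNP unb.
have [a aP] : {a : nat -> E & forall n, A (a n) /\ n%:R < `|a n|}.
  apply: (choice (P := fun n x => A x /\ n%:R < `|x|)) => n.
  have /existsNP[x /not_implyP[Ax /negP]] := unb n%:R.
  by rewrite -ltNge; exists x.
have [g gP] := choice (fun n => positive_norming (a n)).
have gc n x : `|g n x| <= `|x| by have [[_ ->]] := gP n.
pose f (u : nat -> R) (x : E) : R := l1_sum u (fun k => g k x : R^o).
have f_lin x : lin_on (@l1 R) ((fun u => f u x) : (nat -> R) -> R^o).
  by apply: l1_sum_lin => k; exact: gc.
have Df u : l1 u -> Edual (f u).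
  move=> lu; split; last first.
    exists (l1norm u) => x _; rewrite mulrC; apply: l1_sum_norm_le => // k; exact: gc.
  move=> b x y _ _; rewrite -(l1_sum_linr _ lu (fun k => gc k x) (fun k => gc k y)).
  congr l1_sum; apply/funext => k; have [[[gl _] _] _ _] := gP k.
  by rewrite gl.
have fpos u : l1 u -> (forall k, 0 <= u k) -> positive_functional (f u).
  move=> lu u0 x x0; apply: (cvgr_to_ge (l1_sum_cvg lu (fun k => gc k x))).
  apply: nearW => n; rewrite seriesEord /=; apply: sumr_ge0 => k _.
  by apply: mulr_ge0 => //; have [_ + _] := gP k; apply.
(* testing against all of l_1 turns the bounds for positive functionals into a uniform one *)
have [|u|K K0 KP] := @uniform_boundedness R (ell1 R) nat (fun n u => f u (a n)).
- move=> n; split.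
    move=> b u v _ _; rewrite ell1_valD ell1_valZ.
    exact: (f_lin (a n) b _ _ (ell1P u) (ell1P v)).
  exists `|a n| => u _; apply: l1_sum_norm_le (ell1P u) _ => k; exact: gc.
- have lu := ell1P u.
  pose up k := Num.max (u k) 0; pose um k := Num.max (- u k) 0.
  have up0 k : 0 <= up k by rewrite le_max lexx orbT.
  have um0 k : 0 <= um k by rewrite le_max lexx orbT.
  have lup : l1 up.
    apply: (l1_bounded (M := l1norm u)) => n; apply: le_trans (l1_sum_le n lu).
    apply: ler_sum => k _; rewrite /up ger0_norm ?le_max ?lexx ?orbT//.
    by rewrite ge_max ler_norm normr_ge0.
  have lum : l1 um.
    apply: (l1_bounded (M := l1norm u)) => n; apply: le_trans (l1_sum_le n lu).
    apply: ler_sum => k _; rewrite /um ger0_norm ?le_max ?lexx ?orbT//.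
    by rewrite ge_max normr_ge0 andbT -normrN ler_norm.
  have uE : (u : nat -> R) = up - um.
    apply/funext => k; rewrite fct_subE /up /um.
    by have [?|?] := leP (u k) 0; have [?|?] := leP (- u k) 0; lra.
  have [M1 M1P] := almost_grothendieck_positive_bounded (Df _ lup)
    (fpos _ lup up0).
  have [M2 M2P] := almost_grothendieck_positive_bounded (Df _ lum)
    (fpos _ lum um0).
  exists (M1 + M2) => n; rewrite uE (lin_onB (l1_subspace R) (f_lin _))//.
  rewrite (le_trans (ler_normB _ _))// lerD//; [exact: M1P (aP n).1|exact: M2P (aP n).1].
have lunit n : l1 (l1_unit R n) by exact: l1_bounded (l1_unit_sum R n).
(* The norm of [a n] exceeds n > 2 K, yet it is at most 2 |g n (a n)| <= 2 K. *)
pose n := (Num.truncn (2 * K)).+1.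
have := KP n (Ell1 (mem_set (lunit n))).
rewrite /f /= l1_sum_unit => gK.
have nK : 2 * K < n%:R by exact: truncnS_gt.
have n1 : `|Ell1 (mem_set (lunit n)) : ell1 R| <= 1.
  by apply: l1norm_le; exact: l1_unit_sum.
have := (aP n).2; have [_ _] := gP n.
have : K * `|Ell1 (mem_set (lunit n)) : ell1 R| <= K by rewrite ler_piMr// ltW.
by move: gK; lra.
Qed.

End AlmostGrothendieckSet.
End BanachLattice.

(** Through the pairing of l_1 with l_infty, [Psi] becomes a functional on bounded sequences and the
    adjoint image of [y n] becomes the sequence of the y_n (a_k), so that [weak_null_bounded_seqs]
    applies. *)
Lemma almost_grothendieck_l1_sum (R : realType) (E : completeNormedModType R) (j : E -> E -> E)
    (A : set E) (a : nat -> E) (M : R) :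
  almost_grothendieck_set j A -> (forall n, A (a n)) -> (forall n, `|a n| <= M) ->
  almost_grothendieck_op j (@l1 R) (@l1norm R) (fun u => l1_sum u a).
Proof.
move=> AG Aa aM y ynull ydisj Psi [Psil [C PsiC]].
have [Dy y0] := ynull.
have [K K0 yK] : exists2 K, 0 < K & forall n x, `|y n x| <= K * `|x|.
  apply: uniform_boundedness => // x; exact: c0_bounded (y0 x).

have nl1 (u : nat -> R) : l1 u -> 0 <= l1norm u by exact: l1norm_ge0.
have l1P : exists u : nat -> R, l1 u /\ l1norm u <= 1.
  by exists (l1_unit R 0); split; [exact: l1_bounded (l1_unit_sum R 0)|apply: l1norm_le; exact: l1_unit_sum].
pose pair (h u : nat -> R) : R := l1_sum u (h : nat -> R^o).
have Dpair h N : (forall k, `|h k| <= N) -> dual_on (@l1 R) (@l1norm R) (pair h).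
  move=> hN; split; first exact: (l1_sum_lin (W := R^o) hN).
  by exists N => u lu; exact: (l1_sum_norm_le (W := R^o) lu hN).
have Psi_eq f g : dual_on (@l1 R) (@l1norm R) f -> dual_on (@l1 R) (@l1norm R) g ->
    (forall u, l1 u -> f u = g u) -> Psi f = Psi g.
  by move=> Df Dg; apply: (functional_ext_on nl1 Df Dg l1P Psil PsiC).
pose C' := Num.max C 1.
have C'0 : 0 < C' by rewrite lt_max ltr01 orbT.
have psil : lin_on (@bounded_seq R) ((fun h => Psi (pair h)) : (nat -> R) -> R^o).
  move=> b h g [N hN] [L gL].
  have Dh := Dpair _ _ hN; have Dg := Dpair _ _ gL.
  rewrite -(Psil b _ _ Dh Dg); apply: Psi_eq.
  - have [S hgS] : bounded_seq (b *: h + g).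
      by case: (bounded_seq_subspace R) => _; apply; [exists N|exists L].
    exact: Dpair hgS.
  - by case: (dual_on_subspace (@l1 R) (@l1norm R)) => _; apply.
  - by move=> u lu; exact: (l1_sum_linr (W := R^o) b lu hN gL).
have psiC h N : (forall k, `|h k| <= N) -> `|Psi (pair h)| <= C' * N.
  move=> hN; have Dh := Dpair _ _ hN.
  have N0 : 0 <= N by exact: le_trans (hN 0%N).
  have dN : dual_norm (@l1 R) (@l1norm R) (pair h) <= N.
    apply: dual_norm_le => // u lu u1.
    by rewrite (le_trans (l1_sum_norm_le (W := R^o) lu hN))// ler_piMr.
  have d0 : 0 <= dual_norm (@l1 R) (@l1norm R) (pair h).
    by have [u [lu u1]] := l1P; apply: le_trans (dual_norm_ge nl1 Dh lu u1).
  rewrite (le_trans (PsiC _ Dh))// (@le_trans _ _ (C' * dual_norm (@l1 R) (@l1norm R) (pair h)))//.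
    by rewrite ler_wpM2r// le_max lexx.
  by rewrite ler_wpM2l// ltW.
pose h n k := y n (a k).
have hKM n k : `|h n k| <= K * M by rewrite (le_trans (yK _ _))// ler_wpM2l// ltW.
have -> : (fun n => Psi (fun u => y n (l1_sum u a))) = (fun n => Psi (pair (h n))).
  apply/funext => n; have [yl [L yL]] := Dy n; apply: Psi_eq.
  - split.
      by move=> b u v lu lv; rewrite (l1_sum_lin aM)// yl.
    exists (K * M) => u lu; rewrite (le_trans (yK _ _))// -mulrA ler_pM2l//.
    exact: (l1_sum_norm_le lu aM).
  - exact: Dpair (hKM n).
  - move=> u lu; apply/esym; apply: cvg_lim => //.
    exact: (Edual_l1_sum (Dy n) lu aM).
apply: contrapT => psih.
have [e [n_ [k_ [e0 n_ge hk]]]] := weak_null_bounded_seqs psil C'0 psiC hKM psih.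
have [p [cp pP]] := almost_grothendieck_cluster AG ynull ydisj (fun m => Aa (k_ m)).
(* Coordinate [n_ i] of the cluster point is approximated along indices m >= i, where |y (n_ i) (a
   (k_ m))| > e. As [n_ i] is unbounded, this contradicts [c0 p]. *)
have p_big i : e / 2 <= `|p (n_ i)|.
  have e20 : 0 < e / 2 by rewrite divr_gt0.
  have [m im pm] := pP (n_ i) _ i e20.
  have := hk _ _ im; rewrite /h.
  have := lerB_normD (y (n_ i) (a (k_ m))) (- p (n_ i)); rewrite normrN.
  by move: pm; lra.
have e20 : 0 < e / 2 by rewrite divr_gt0.
have /cvgrPdist_lt/(_ _ e20)[N _ NP] := cp.
have := NP _ (n_ge N); rewrite /= sub0r normrN.
by have := p_big N; lra.
Qed.

Theorem mainTheorem4 (R : realType) (E : completeNormedModType R)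
  (j : E -> E -> E) :
  is_banach_lattice j ->
  [<-> (* (1) *)
       (forall A : set E, almost_grothendieck_set j A ->
          rel_weak_compact setT (@Num.norm R E) A);
       (* (2) *)
       (forall (X : completeNormedModType R) (T : X -> E),
          bounded_op setT (@Num.norm R X) T ->
          almost_grothendieck_op j setT (@Num.norm R X) T ->
          weakly_compact_op setT (@Num.norm R X) T);
       (* (3) *)
       (forall T : (nat -> R) -> E,
          bounded_op (@l1 R) (@l1norm R) T ->
          almost_grothendieck_op j (@l1 R) (@l1norm R) T ->
          weakly_compact_op (@l1 R) (@l1norm R) T)].
Proof.
move=> blE; tfae.
- move=> AGwc X T bT AGT; apply: AGwc; exact: almost_grothendieck_image.
(* Condition (2) concerns types, so [T] is carried over to [ell1 R]. A functional on the dual of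
   [ell1 R] is pulled back along the restriction of functionals to [ell1 R], and [imE] makes the two
   dual norms agree. *)
- move=> opwc T [Tl [C TC]] AGT.
  pose T' (u : ell1 R) := T u.
  have bT' : bounded_op setT (@Num.norm R (ell1 R)) T'.
    split; last by exists C => u _; exact: TC (ell1P u).
    move=> a u v _ _; rewrite /T' ell1_valD ell1_valZ; exact: Tl (ell1P u) (ell1P v).
  have imE (f : (nat -> R) -> R) :
      [set r | exists u : ell1 R, [/\ [set: ell1 R] u, `|u| <= 1 & r = `|f u|]] =
      [set r | exists u, [/\ l1 u, l1norm u <= 1 & r = `|f u|]].
    apply/seteqP; split=> r [u]; first by move=> [_ u1 ->]; exists u; split=> //; exact: ell1P.
    by move=> [lu u1 ->]; exists (Ell1 (mem_set lu)).
  have AGT' : almost_grothendieck_op j setT (@Num.norm R (ell1 R)) T'.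
    move=> y ynull ydisj Psi [Psil [K PsiK]].
    have res f : dual_on (@l1 R) (@l1norm R) f ->
        dual_on setT (@Num.norm R (ell1 R)) (fun u : ell1 R => f u).
      move=> [fl [L fL]]; split; last by exists L => u _; exact: fL (ell1P u).
      by move=> a u v _ _; rewrite ell1_valD ell1_valZ; exact: fl (ell1P u) (ell1P v).
    apply: (AGT y ynull ydisj (fun f => Psi (fun u : ell1 R => f u))); split.
      by move=> a f g Df Dg; rewrite -(Psil a _ _ (res _ Df) (res _ Dg)).
    by exists K => f Df; have := PsiK _ (res _ Df); rewrite /dual_norm imE.
  have := opwc _ T' bT' AGT'; rewrite /weakly_compact_op.
  suff -> : [set T' u | u in [set u : ell1 R | [set: ell1 R] u /\ `|u| <= 1]] =
            [set T u | u in [set u | l1 u /\ l1norm u <= 1]] by [].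
  apply/seteqP; split=> x [u].
    by move=> [_ u1] <-; exists u => //; split=> //; exact: ell1P.
  by move=> [lu u1] <-; exists (Ell1 (mem_set lu)).
- move=> opwc A AG.
  have [M AM] := almost_grothendieck_bounded blE AG.
  apply: (eberlein_smulian AM) => a Aa.
  have aM n : `|a n| <= M by exact: AM.
  have KT : weakly_compact_op (@l1 R) (@l1norm R) (fun u => l1_sum u a).
    apply: opwc; last exact: almost_grothendieck_l1_sum AG Aa aM.
    split; first exact: l1_sum_lin aM.
    by exists M => u lu; exact: (l1_sum_norm_le lu aM).
  have [//||p [_ pclust]] := rel_weak_compact_cluster (b := a) KT; last by exists p.
  move=> n; exists (l1_unit R n); last exact: l1_sum_unit.
  by split; [exact: l1_bounded (l1_unit_sum R n)|apply: l1norm_le; exact: l1_unit_sum].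
Qed.
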